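(* Let $\mathfrak g$ be the local symmetry algebra of the nonlocal Euler--Lagrange equation $$\nabla_u L(x,u,u',K*S(u)) - \partial_x \nabla_v L(x,u,u',K*S(u)) + DS(u)^T\, K*\nabla_n L(x,u,u',K*S(u)) = 0. \qquad (\mathrm{EL})$$ For any given $\xi\in\mathfrak g$, define the function $\mathcal C_\xi : C^R_b(\mathbb R,\mathbb R^d)\to C^0_b(\mathbb R,\mathbb R)$ by $$\mathcal C_\xi(u)(x) := L\big(x,u(x),u'(x),K*S(u)(x)\big)\,\mathbf 1_\xi + \nabla_v L\big(x,u(x),u'(x),K*S(u)(x)\big)\cdot u_\xi(x) + \mathcal B_\xi(\phi_x u).$$ Here $\mathcal B_\xi$ is the functional $$\mathcal B_\xi(u) := \iint_Q \big(\sigma(x,y)-\sigma(y,x)\big)\,dx\,dy,\qquad Q := (-\infty,0)\times(0,\infty),$$ with $$\sigma(x,y) := \nabla_n L\big(x,u(x),u'(x),K*S(u)(x)\big)\cdot K(x-y)\,DS(u(y))\,u_\xi(y),$$ and $\mathcal B_\xi(\phi_x u)$ is this functional evaluated at the shifted function $\phi_x u$. Then $x\mapsto \mathcal C_\xi(u)(x)$ is constant, for any $u\in C^R_b(\mathbb R,\mathbb R^d)$ which solves (EL).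
   Context: $\mathcal M(\mathbb R^d)$ denotes real $d\times d$ matrices. The kernel $K:\mathbb R\to\mathcal M(\mathbb R^d)$ satisfies $K(r)=K(-r)$, $K(r)=K(r)^T$, $K\in L^1(\mathbb R,\mathcal M(\mathbb R^d))$, and $\int_{\mathbb R}(1+|r|)\|K(r)\|\,dr<\infty$. $S\in C^2(\mathbb R^d,\mathbb R^d)$, and $K*S(u)(x)=\int_{\mathbb R}K(x-y)S(u(y))\,dy$. The Lagrangian $L=L(x,u,v,n)$ is in $C^2(\mathbb R\times\mathbb R^d\times\mathbb R^d\times\mathbb R^d,\mathbb R)$. Set $R=1$ if $\nabla_vL=0$ and $R=2$ otherwise. $C^k_b(\mathbb R,\mathbb R^d)$ is the space of $C^k$ functions which are uniformly bounded together with their first $k$ derivatives. For $a,b\in\mathbb R$, $\mathcal A(u,a,b):=\int_a^b L(x,u(x),u'(x),K*S(u)(x))\,dx$. Let $\phi_\tau u(x):=u(x+\tau)$. The group $GL(d)\times\mathbb R$ acts on functions $u:\mathbb R\to\mathbb R^d$ by $g\bullet u:=\phi_\tau(Au)$ and on $\mathbb R$ by $g\bullet x:=x-\tau$, for $g=(A,\tau)$; and $g\bullet(u,a,b)=(g\bullet u,g\bullet a,g\bullet b)$. For $\xi$ in the Lie algebra of $GL(d)\times\mathbb R$ define the induced infinitesimal actions $u_\xi:=\frac{d}{d\tau}\exp_e(\tau\xi)\bullet u\big|_{\tau=0}$ and $\mathbf 1_\xi:=\frac{d}{d\tau}\exp_e(\tau\xi)\bullet 1\big|_{\tau=0}$.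 (Thus for $\xi=(X,t)\in\mathfrak{gl}(d)\times\mathbb R$ one has $u_\xi=Xu+tu'$, $\mathbf 1_\xi=-t$.) The local symmetry algebra of (EL) is the maximal Lie subalgebra $\mathfrak g$ of the Lie algebra of $GL(d)\times\mathbb R$ such that $D\mathcal A(u,a,b)(u_\xi,\mathbf 1_\xi,\mathbf 1_\xi)=0$ for all $(u,a,b)\in C^R_b(\mathbb R,\mathbb R^d)\times\mathbb R^2$ and all $\xi\in\mathfrak g$, where $D\mathcal A(u,a,b)(u_\xi,\mathbf 1_\xi,\mathbf 1_\xi)=\frac{d}{d\tau}\mathcal A(\exp_e(\tau\xi)\bullet(u,a,b))\big|_{\tau=0}$.
   Formalization: In B_ξ(φ_x u) the explicit position argument of L is shifted by x too (unshifted is false for x-dependent L); that C_ξ(u) lies in C^0_b is claimed when L, ∇_vL, ∇_nL are bounded uniformly in x on bounded sets; constancy assumes the integral B_ξ converges. *)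

(* Defs.v *)
From HB Require Import structures.
From mathcomp Require Import all_boot all_order all_algebra.
From mathcomp Require Import all_classical all_reals all_analysis.
Set Implicit Arguments.
Unset Strict Implicit.
Unset Printing Implicit Defensive.
Import Order.TTheory GRing.Theory Num.Theory.
Import numFieldNormedType.Exports.
Local Open Scope ring_scope.
Local Open Scope classical_set_scope.

Section Calculus.
Context {R : realType}.

(* In finite dimension, existence and continuity of all directional
   derivatives up to order k is the usual C^k regularity. *)
Fixpoint Ck (V W : normedModType R) (k : nat) (f : V -> W) : Prop :=
  continuous f /\
  if k is k'.+1 then
    (forall x v, derivable f x v) /\ (forall v, Ck k' (fun x => 'D_v f x))
  else True.

Definition Cb (W : normedModType R) (k : nat) (f : R -> W) : Prop :=
  Ck k f /\
  forall j, (j <= k)%N -> exists M : R, forall x, `|derive1n j f x| <= M.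

(* \int_a^b with orientation, for a, b in any order *)
Definition oint (a b : R) (f : R -> R) : R :=
  \int[lebesgue_measure]_(x in `[a, b]) f x -
  \int[lebesgue_measure]_(x in `[b, a]) f x.

Context {d : nat}.
Notation vec := 'cV[R]_d.
Notation mat := 'M[R]_d.

Definition dotv (a b : vec) : R := \sum_i a i 0 * b i 0.

Definition grad (f : vec -> R) (u : vec) : vec :=
  \col_i 'D_(delta_mx i 0) f u.

Definition Dmat (S : vec -> vec) (u : vec) : mat :=
  \matrix_(i, j) ('D_(delta_mx j 0) S u) i 0.

Definition conv (K : R -> mat) (f : R -> vec) (x : R) : vec :=
  \col_i \int[lebesgue_measure]_y ((K (x - y) *m f y) i 0).

(* absolute convergence of the integrals defining [conv K f x]; the Lebesgue
   integral of the library is total *)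
Definition conv_defined (K : R -> mat) (f : R -> vec) (x : R) : Prop :=
  forall i, lebesgue_measure.-integrable [set: R]
              (fun y => ((K (x - y) *m f y) i 0)%:E).

Definition expmx (X : mat) : mat :=
  lim (series (fun k => (k`!%:R)^-1 *: X ^+ k) @ \oo).

End Calculus.

Section Action.
Context {R : realType} {d : nat}.
Notation vec := 'cV[R]_d.
Notation mat := 'M[R]_d.

(* Elements of GL(d) x R and of its Lie algebra gl(d) x R are both pairs
   (matrix, real). *)
Definition phi (W : Type) (tau : R) (u : R -> W) : R -> W :=
  fun x => u (x + tau).

Definition act_fun (g : mat * R) (u : R -> vec) : R -> vec :=
  phi g.2 (fun x => g.1 *m u x).

Definition act_pt (g : mat * R) (x : R) : R := x - g.2.

(* [gexp tau xi] is exp_e(tau xi) *)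
Definition gexp (tau : R) (xi : mat * R) : mat * R :=
  (expmx (tau *: xi.1), tau * xi.2).

Definition inf_fun (xi : mat * R) (u : R -> vec) : R -> vec :=
  fun x => derive1 (fun tau : R => act_fun (gexp tau xi) u x) 0.

Definition inf_one (xi : mat * R) : R :=
  derive1 (fun tau : R => act_pt (gexp tau xi) 1 : R) 0.

Definition lie_bracket (xi eta : mat * R) : mat * R :=
  (xi.1 *m eta.1 - eta.1 *m xi.1, 0).

Definition lie_subalgebra (g : set (mat * R)) : Prop :=
  [/\ g (0, 0),
      (forall (c : R) xi eta, g xi -> g eta ->
         g (c *: xi.1 + eta.1, c * xi.2 + eta.2)) &
      (forall xi eta, g xi -> g eta -> g (lie_bracket xi eta))].

End Action.

Section Lagrangian.
Context {R : realType} {d : nat}.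
Notation vec := 'cV[R]_d.
Notation mat := 'M[R]_d.
Implicit Types (L : R -> vec -> vec -> vec -> R) (K : R -> mat)
  (S : vec -> vec) (u : R -> vec) (xi : mat * R).

Definition lagrangian_C2 L : Prop :=
  Ck 2 (fun p : R * vec * vec * vec => L p.1.1.1 p.1.1.2 p.1.2 p.2 : R).

Definition even_sym_kernel K : Prop :=
  [/\ (forall r, K (- r) = K r), (forall r, (K r)^T = K r),
      (forall i j, lebesgue_measure.-integrable [set: R]
                     (fun r => (K r i j)%:E)) &
      lebesgue_measure.-integrable [set: R]
        (fun r => ((1 + `|r|) * `|K r|)%:E)].

Definition grad_u L x a b c : vec := grad (fun a' => L x a' b c) a.
Definition grad_v L x a b c : vec := grad (fun b' => L x a b' c) b.
Definition grad_n L x a b c : vec := grad (fun c' => L x a b c') c.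

(* The exponent R of the space C^R_b. *)
Definition reg L : nat :=
  if `[< forall x a b c, grad_v L x a b c = 0 >] then 1%N else 2%N.

(* x |-> F(x, u(x), u'(x), K*S(u)(x)) *)
Definition along (T : Type) (F : R -> vec -> vec -> vec -> T) K S u (x : R) : T :=
  F x (u x) (derive1 u x) (conv K (S \o u) x).

Definition action_fun L K S u (a b : R) : R := oint a b (along L K S u).

Definition solves_EL L K S u : Prop := forall x : R,
  conv_defined K (along (grad_n L) K S u) x /\
  along (grad_u L) K S u x - derive1 (along (grad_v L) K S u) x
    + (Dmat S (u x))^T *m conv K (along (grad_n L) K S u) x = 0.

(* D A(u, a, b)(u_xi, 1_xi, 1_xi) = 0 for all (u, a, b) *)
Definition inf_symmetry L K S xi : Prop :=
  forall u (a b : R), Cb (reg L) u ->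
    is_derive (0 : R) (1 : R)
      (fun tau : R => action_fun L K S (act_fun (gexp tau xi) u)
                        (act_pt (gexp tau xi) a) (act_pt (gexp tau xi) b) : R)
      (0 : R).

Definition local_symmetry_algebra L K S (g : set (mat * R)) : Prop :=
  [/\ lie_subalgebra g, g `<=` inf_symmetry L K S &
      forall h, lie_subalgebra h -> h `<=` inf_symmetry L K S ->
        g `<=` h -> h `<=` g].

Definition sigma L K S xi u (x y : R) : R :=
  dotv (along (grad_n L) K S u x)
       (K (x - y) *m (Dmat S (u y) *m inf_fun xi u y)).

Definition quadrant : set (R * R) := [set p | p.1 < 0 /\ 0 < p.2].

Definition B_integrand L K S xi u (p : R * R) : R :=
  sigma L K S xi u p.1 p.2 - sigma L K S xi u p.2 p.1.

Definition B_defined L K S xi u : Prop :=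
  (lebesgue_measure \x lebesgue_measure)%E.-integrable quadrant
    (EFin \o B_integrand L K S xi u).

Definition B_fun L K S xi u : R :=
  \int[(lebesgue_measure \x lebesgue_measure)%E]_(p in quadrant)
     B_integrand L K S xi u p.

(* B_xi(phi_x u): shifting translates the whole integrand sigma, so the
   explicit dependence of L on position is shifted together with u.  When L
   does not depend on position, [phi x L] is [L]; when it does, leaving it
   unshifted would make the conservation law false. *)
Definition C_fun L K S xi u (x : R) : R :=
  along L K S u x * inf_one xi
  + dotv (along (grad_v L) K S u x) (inf_fun xi u x)
  + B_fun (phi x L) K S xi (phi x u).

(* convergence of the integral in [C_fun L K S xi u x] *)
Definition C_defined L K S xi u (x : R) : Prop :=
  B_defined (phi x L) K S xi (phi x u).

(* Automatic for L of class C^2 not depending on position.  Without it, the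
   superposition operators of L and its gradients need not map bounded
   functions to bounded functions. *)
Definition position_bounded L : Prop :=
  forall M : R, exists N : R, forall x a b c,
    `|a| <= M -> `|b| <= M -> `|c| <= M ->
    [/\ `|L x a b c| <= N, `|grad_v L x a b c| <= N &
        `|grad_n L x a b c| <= N].

End Lagrangian.

(* Main.v *)
Require Import Defs.
From HB Require Import structures.
From mathcomp Require Import all_boot all_order all_algebra.
From mathcomp Require Import all_classical all_reals all_analysis.
From mathcomp Require Import measurable_realfun ring lra.
(* Makes [conv] denote the convolution again, rather than its homonym on convex
   spaces. *)
Import Defs.

(** Let p = (x, u, u', K*S(u)) be the jet of u, n its last component, xi = (X, t),
and let the prime denote derivation along u.

Pointwise form of the symmetry. The flow of xi replaces u by
z |-> exp(s X) u(z + s t) and shifts [a, b] by - s t.  Translating the integral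
back to [a, b], the transformed action is the integral over [a, b] of L at
(z - s t, exp(s X) u, exp(s X) u', K*S(exp(s X) u)), by translation invariance of
the convolution.  This point has a first-order expansion p + s q + o(s), uniform on
[a, b], with q = (- t, X u, X u', K*(DS(u) X u)).  Hence one may differentiate under
the integral sign; the derivative vanishes on every interval and its integrand is
continuous, so the derivative of L at p in the direction q is zero at every point
([symmetry_identity]).

Local balance. Let ell = L 1_xi + grad_v L . u_xi be the local part of the current.
In ell', the equation (EL) tested against X u and against u' eliminates grad_u L
and the derivative of grad_v L, and the previous identity eliminates the partial
derivative in x.  What is left is nonlocal:
ell' = K*gn . W - gn . K*W, with gn = grad_n L and W = DS(u) u_xi
([local_current_balance]).  As K is even and symmetric, this is minus the integral
in y of s(x, y) = sigma(x, y) - sigma(y, x).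

Flux. Translated by x, the functional B becomes the integral of s over the quadrant
(-oo, x) x (x, +oo).  For x1 < x2 the indicator of the quadrant at x2 minus that of
the quadrant at x1 is, almost everywhere, the indicator of the strip [x1, x2) x R
minus that of (-oo, x2)^2 \ (-oo, x1)^2.  The latter set is invariant under the
exchange of the coordinates and s is antisymmetric, so it contributes nothing
([flux_difference]).  The increment of B is therefore the integral over [x1, x2] of
the integral of s(x, .), which is minus the increment of ell.

Regularity. The integral of |k(x - y)| over the quadrant x < 0 < y is at most the
first moment of |k|, because the section of direction x - y = - r has length r.
When L and its gradients are bounded along u, the kernel thus dominates s and all of
its translates, which gives convergence, boundedness and, by dominated convergence,
continuity of the nonlocal part of the current. *)

Set Implicit Arguments.
Unset Strict Implicit.
Unset Printing Implicit Defensive.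
Import Order.TTheory GRing.Theory Num.Theory.
Import numFieldNormedType.Exports.
Local Open Scope ring_scope.
Local Open Scope classical_set_scope.

(** * Finite-dimensional normed modules *)

Section FiniteDimension.
Context {R : realType}.

(** Bounded linear coordinates with respect to finitely many vectors, and compact sets
containing the balls.  Stated as existence of such data because this form passes to
products, hence to the space of jets. *)
Definition findim (V : normedModType R) : Prop :=
  (exists (I : finType) (e : I -> V) (c : I -> V -> R),
    [/\ forall v, v = \sum_i c i v *: e i,
        forall i v, `|c i v| <= `|v| &
        forall i (a : R) u v, c i (a *: u + v) = a * c i u + c i v]) /\
  (forall M : R, exists2 C : set V, compact C & forall v, `|v| <= M -> C v).

Lemma mx_norm_leP m n (A : 'M[R]_(m, n)) (M : R) : 0 <= M ->
  (`|A| <= M) <-> (forall i j, `|A i j| <= M).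
Proof.
move=> M0; rewrite [`|A|]/Num.Def.normr/= mx_normrE; split=> [AM i j|AM].
  exact: le_trans (le_bigmax 0 (fun ij : 'I_m * 'I_n => `|A ij.1 ij.2|) (i, j)) AM.
by apply: bigmax_le => // -[i j] _; exact: AM.
Qed.

Lemma mx_entry_le m n (A : 'M[R]_(m, n)) i j : `|A i j| <= `|A|.
Proof. by move: i j; apply/mx_norm_leP. Qed.

Lemma findimR : findim R.
Proof.
split.
  exists unit, (fun=> 1), (fun=> id); split => //=.
  by move=> v; rewrite big_const card_unit/= addr0 [RHS]mulr1.
move=> M; exists `[-M, M]; first exact: segment_compact.
by move=> v; rewrite ler_norml /= in_itv/=.
Qed.

Lemma findim_cV d : findim 'cV[R]_d.
Proof.
split.
  exists 'I_d, (fun i => delta_mx i 0), (fun i (v : 'cV[R]_d) => v i 0); split => //=.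
  - by move=> v; rewrite [LHS]matrix_sum_delta; apply: eq_bigr => i _; rewrite big_ord1.
  - by move=> i v; exact: mx_entry_le.
  - by move=> i a u v; rewrite !mxE.
move=> M.
pose T : 'rV[R]_d -> 'cV[R]_d := trmx.
have cT : continuous T.
  move=> x; apply/(@cvgrPdist_le _ _ _ (nbhs x) _ T) => e e0.
  apply/nbhs_ballP; exists e => //= y.
  rewrite -ball_normE /= => xy; apply/mx_norm_leP; first exact: ltW.
  move=> i j; rewrite !mxE.
  have -> : x j i - y j i = (x - y) j i by rewrite !mxE.
  exact: le_trans (mx_entry_le _ _ _) (ltW xy).
exists (T @` [set v : 'rV[R]_d | forall i, `[-M, M] (v ord0 i)]).
  apply: continuous_compact; first exact: continuous_subspaceT.
  by apply: (@rV_compact _ _ (fun=> `[-M, M]%classic)) => i; exact: segment_compact.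
move=> v vM; exists v^T; last exact: trmxK.
move=> i /=; rewrite in_itv/= -ler_norml mxE.
exact: le_trans (mx_entry_le _ _ _) vM.
Qed.

Lemma findim_prod (U V : normedModType R) :
  findim U -> findim V -> findim (U * V)%type.
Proof.
move=> [[I [e [c [ce cn cl]]]] Uc] [[J [e' [c' [ce' cn' cl']]]] Vc]; split.
  exists (I + J)%type.
  exists (fun k => match k with inl i => (e i, 0) | inr j => (0, e' j) end).
  exists (fun k p => match k with inl i => c i p.1 | inr j => c' j p.2 end).
  split=> /=.
  - case=> u v; rewrite big_sumType/=.
    have raddf_pair (r : seq I) F G : \sum_(i <- r) (F i, G i) =
        (\sum_(i <- r) F i, \sum_(i <- r) G i) :> U * V.
      by elim: r => [|i r IH]; rewrite !(big_nil, big_cons)// IH.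
    have raddf_pair' (r : seq J) F G : \sum_(i <- r) (F i, G i) =
        (\sum_(i <- r) F i, \sum_(i <- r) G i) :> U * V.
      by elim: r => [|i r IH]; rewrite !(big_nil, big_cons)// IH.
    rewrite [X in _ = X + _](_ : _ = \sum_i (c i u *: e i, c i u *: 0))//.
    rewrite [X in _ = _ + X](_ : _ = \sum_i (c' i v *: 0, c' i v *: e' i))//.
    rewrite raddf_pair raddf_pair' -ce -ce'.
    rewrite [X in _ = (_, X) + _]big1 => [|i _]; last by rewrite scaler0.
    rewrite [X in _ = _ + (X, _)]big1 => [|i _]; last by rewrite scaler0.
    by rewrite /GRing.add/= /add_pair/= addr0 add0r.
  - move=> [i|j] [u v] /=; rewrite prod_normE le_max ?cn ?cn' ?orbT//.
  - by move=> [i|j] a [u v] [u' v'] /=; rewrite ?cl ?cl'.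
move=> M; have [C Cc CM] := Uc M; have [C' Cc' CM'] := Vc M.
exists (C `*` C'); first exact: compact_setX.
by move=> [u v]; rewrite prod_normE ge_max /= => /andP[? ?]; split; auto.
Qed.

Lemma compact_continuous_bounded (T : topologicalType) (W : normedModType R)
    (f : T -> W) (A : set T) : compact A -> continuous f ->
  exists2 B : R, 0 <= B & forall v, A v -> `|f v| <= B.
Proof.
move=> cA cf.
have /compact_bounded[B [_ BP]] : compact (f @` A).
  by apply: continuous_compact => //; exact: continuous_subspaceT.
exists (`|B| + 1); first by rewrite addr_ge0.
move=> v Av; apply: (BP (`|B| + 1)); last by exists v.
by rewrite (le_lt_trans (ler_norm B))// ltrDl.
Qed.

(** Stronger than uniform continuity on [A]: only one of the two points is required to
lie in [A].  The first-order expansions below need this, since the displaced point may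
leave the compact set. *)
Lemma unif_cont_compact (V W : normedModType R) (f : V -> W) (A : set V) :
  compact A -> continuous f -> forall e : R, 0 < e ->
  exists2 eta : R, 0 < eta & forall p q, A p -> `|q - p| <= eta ->
    `|f q - f p| <= e.
Proof.
move=> /compact_near_coveringP cA cf e e0.
have := cA R (0^'+) (fun eta p => forall q, `|q - p| <= eta -> `|f q - f p| <= e).
have /[swap]/[apply] : forall x, A x ->
    \forall x' \near x & t \near 0^'+, forall q, `|q - x'| <= t -> `|f q - f x'| <= e.
  move=> x _.
  have e2 : 0 < e / 2 by rewrite divr_gt0.
  have /cvgrPdist_le/(_ _ e2)/nbhs_ballP[r /= r0 fr] := cf x.
  have r2 : 0 < r / 2 by rewrite divr_gt0.
  exists (ball x (r / 2), [set t | t < r / 2]).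
    by split => /=; [exact: nbhsx_ballx|exact: nbhs_right_lt].
  move=> [p t] /= [xp tr] q qp.
  rewrite -(subrKA (f x)) (splitr e).
  have xp' : `|x - p| < r / 2 by move: xp; rewrite -ball_normE.
  rewrite (le_trans (ler_normD _ _))// lerD//.
    rewrite distrC; apply: fr; rewrite -ball_normE/=.
    rewrite -(subrKA p) (splitr r) (le_lt_trans (ler_normD _ _))// ltrD//.
    by rewrite distrC; exact: le_lt_trans qp tr.
  apply: fr; rewrite -ball_normE/= (lt_trans xp')//.
  by rewrite ltr_pdivrMr// mulr2n mulrDr mulr1 ltrDl.
move=> [] // r /= r0 rA; exists (r / 2); first by rewrite divr_gt0.
move=> p q Ap qp; apply: (rA (r / 2)) => //=.
  rewrite sub0r normrN gtr0_norm ?divr_gt0//.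
  by rewrite ltr_pdivrMr// mulr2n mulrDr mulr1 ltrDl.
by rewrite divr_gt0.
Qed.

Lemma is_derive_line (V W : normedModType R) (f : V -> W) (q e : V) (s : R) d :
  is_derive (q + s *: e) e f d -> is_derive s 1 (fun t => f (q + t *: e)) d.
Proof.
move=> [dF dE].
have E : (fun h : R => h^-1 *: (((fun t => f (q + t *: e)) \o shift s) (h *: 1)
   - f (q + s *: e)))
   = (fun h : R => h^-1 *: ((f \o shift (q + s *: e)) (h *: e) - f (q + s *: e))).
  apply/funext => h /=; do 3 f_equal.
  by rewrite [h *: 1]mulr1 scalerDl addrCA.
by split; [rewrite /derivable E|rewrite /derive E].
Qed.

(** Mean value theorem on the segment from [q] to [q + c *: e], in a form that covers
both signs of [c]. *)
Lemma dir_mvt (V : normedModType R) (f : V -> R) (q e : V) (c : R) :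
  (forall x, derivable f x e) ->
  exists2 t, 0 <= t <= 1 & f (q + c *: e) - f q = c * 'D_e f (q + (t * c) *: e).
Proof.
move=> df; pose g (s : R) := f (q + s *: e).
have dg (s : R) : is_derive s 1 g ('D_e f (q + s *: e)).
  exact/is_derive_line/derivableP/df.
have cg : continuous g.
  by move=> s; apply/differentiable_continuous/derivable1_diffP; case: (dg s).
have g0 : g 0 = f q by rewrite /g scale0r addr0.
case: (ltgtP c 0) => [c0|c0|->].
- have [|x xc E] := @MVT_segment R g _ c 0 (ltW c0) (fun s _ => dg s).
    exact: continuous_subspaceT.
  exists (x / c).
    move: xc; rewrite in_itv/= => /andP[cx x0].
    rewrite ler_ndivlMr// mul0r ler_ndivrMr// mul1r.
    by rewrite x0 cx.
  rewrite divfK ?lt_eqF// -g0 -opprB [g 0 - _]E; ring.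
- have [|x xc E] := @MVT_segment R g _ 0 c (ltW c0) (fun s _ => dg s).
    exact: continuous_subspaceT.
  exists (x / c).
    move: xc; rewrite in_itv/= => /andP[cx x0].
    rewrite ler_pdivlMr// mul0r ler_pdivrMr// mul1r.
    by rewrite x0 cx.
  rewrite divfK ?gt_eqF// -g0 [_ - g 0]E; ring.
- by exists 0; rewrite ?lexx ?ler01// scale0r addr0 subrr mul0r.
Qed.

End FiniteDimension.

(** * Functions of class C1 in finite dimension *)

Lemma continuous_bigsum {R : realType} (X : topologicalType) (I : Type)
    (r : seq I) (F : I -> X -> R) :
  (forall i, continuous (F i)) -> continuous (fun x => \sum_(i <- r) F i x).
Proof.
move=> cF; elim: r => [|i r IH].
  by under eq_fun do rewrite big_nil; exact: cst_continuous.
under eq_fun do rewrite big_cons.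
by move=> x; apply: cvgD; [exact: cF|exact: IH].
Qed.

Section C1.
Context {R : realType} {V : normedModType R}.
Variables (I : finType) (e : I -> V) (c : I -> V -> R).
Hypothesis ce : forall v, v = \sum_i c i v *: e i.
Hypothesis cn : forall i v, `|c i v| <= `|v|.
Hypothesis cl : forall i (a : R) u v, c i (a *: u + v) = a * c i u + c i v.
Hypothesis cK : forall M : R, exists2 C : set V, compact C & forall v, `|v| <= M -> C v.
Variable f : V -> R.
Hypothesis f1 : Ck 1 f.

Let T p v : R := \sum_i c i v * 'D_(e i) f p.

(** Moving from [p] to [p + v] one coordinate at a time, each increment is a directional
derivative at an intermediate point by the mean value theorem; these derivatives are
close to those at [p] because they are continuous, hence uniformly so near compact
sets. *)
Let expandT (M eps : R) : 0 < eps -> exists2 eta : R, 0 < eta & forall p v,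
  `|p| <= M -> `|v| <= eta -> `|f (p + v) - f p - T p v| <= eps * `|v|.
Proof.
move=> eps0; have [C cC CM] := cK M.
have [_ [df cDf]] := f1.
pose eps' := eps / (#|I|%:R + 1).
have N0 : 0 < #|I|%:R + 1 :> R by rewrite ltr_wpDl.
have eps'0 : 0 < eps' by rewrite divr_gt0.
have [t [t0 tP]] : exists t : R, 0 < t /\ forall i, forall p q, C p -> `|q - p| <= t ->
    `|'D_(e i) f q - 'D_(e i) f p| <= eps'.
  suff : \forall t \near (0:R)^'+, 0 < t /\ forall i, forall p q, C p -> `|q - p| <= t ->
    `|'D_(e i) f q - 'D_(e i) f p| <= eps' by move/(@filter_ex _ _ _).
  near=> t; split; first by near: t; exact: nbhs_right_gt.
  near: t; apply: filter_forall => i.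
  have [cDfi _] := cDf (e i).
  have [r r0 rP] := unif_cont_compact cC cDfi eps'0.
  near=> t => p q Cp qp; apply: rP => //; apply: (le_trans qp).
  by near: t; exact: nbhs_right_le.
pose K := \sum_i `|e i|.
have K0 : 0 <= K by exact: sumr_ge0.
exists (t / (K + 1)); first by rewrite divr_gt0// ltr_wpDl.
move=> p v pM vt.
(* The induction moves the base point [q], so the distance from [p] to [q] shares the
   budget [t] with the displacements still to be made. *)
have claim (r : seq I) q : `|q - p| + \sum_(i <- r) `|c i v| * `|e i| <= t ->
    `|f (q + \sum_(i <- r) c i v *: e i) - f q - \sum_(i <- r) c i v * 'D_(e i) f p|
      <= eps' * \sum_(i <- r) `|c i v|.
  elim: r q => [|i r IH] q; first by move=> _; rewrite !big_nil addr0 subrr subr0 normr0 mulr0.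
  rewrite !big_cons => qt.
  have [s /andP[s0 s1] sE] := dir_mvt q (c i v) (fun x => df x (e i)).
  have Sr : 0 <= \sum_(j <- r) `|c j v| * `|e j|.
    by apply: sumr_ge0 => j _; rewrite mulr_ge0.
  have -> : f (q + (c i v *: e i + \sum_(j <- r) c j v *: e j)) - f q -
      (c i v * 'D_(e i) f p + \sum_(j <- r) c j v * 'D_(e j) f p) =
      c i v * ('D_(e i) f (q + (s * c i v) *: e i) - 'D_(e i) f p) +
      (f ((q + c i v *: e i) + \sum_(j <- r) c j v *: e j) - f (q + c i v *: e i)
       - \sum_(j <- r) c j v * 'D_(e j) f p).
    by rewrite mulrBr -sE addrA; ring.
  rewrite [leRHS]mulrDr (le_trans (ler_normD _ _))// lerD//.
    rewrite normrM mulrC ler_wpM2r// tP//; first exact: CM.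
    rewrite addrAC (le_trans (ler_normD _ _))//.
    rewrite (le_trans _ qt)// lerD2l normrZ normrM (ger0_norm s0).
    rewrite ler_wpDr// ler_wpM2r//.
    by rewrite ler_piMl.
  apply: IH; rewrite (le_trans _ qt)// addrA lerD2r addrAC.
  by rewrite (le_trans (ler_normD _ _))// normrZ.
have := claim (index_enum I) p; rewrite subrr normr0 add0r -ce => /(_ _) H.
apply: le_trans (H _) _.
  apply: (@le_trans _ _ (\sum_i `|v| * `|e i|)).
    by apply: ler_sum => i _; rewrite ler_wpM2r.
  rewrite -mulr_sumr -/K.
  apply: (@le_trans _ _ (t / (K + 1) * (K + 1))).
    by rewrite ler_pM// lerDl.
  by rewrite divfK// gt_eqF// ltr_wpDl.
rewrite /eps' -mulrA ler_wpM2l//; first exact: ltW.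
rewrite [leLHS]mulrC ler_pdivrMr//.
apply: (@le_trans _ _ (\sum_(i : I) `|v|)); first exact: ler_sum.
by rewrite sumr_const -[leLHS]mulr_natr ler_wpM2l// lerDl.
Unshelve. all: end_near. Qed.

Let T_linear p : linear (T p : V -> R).
Proof.
move=> a u v; rewrite /T scaler_sumr -big_split/=.
by apply: eq_bigr => i _; rewrite cl mulrDl -mulrA.
Qed.

Let T_bound p v : `|T p v| <= (\sum_i `|'D_(e i) f p|) * `|v|.
Proof.
rewrite mulr_suml (le_trans (ler_norm_sum _ _ _))//.
by apply: ler_sum => i _; rewrite normrM mulrC ler_wpM2l.
Qed.

(** The expansion identifies the linear form [T p] as the differential; this is where
existence and continuity of directional derivatives is turned into
differentiability. *)
Let T_diff p : differentiable f p /\ 'd f p = T p :> (V -> R).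
Proof.
pose TL : {linear V -> R} := HB.pack (T p) (GRing.isLinear.Build _ _ _ _ (T p) (@T_linear p)).
have cTL : continuous TL.
  apply: bounded_linear_continuous.
  apply/linear_boundedP; near=> M => x /=.
  rewrite (le_trans (T_bound p x))// ler_wpM2r//.
have E : f \o shift p = cst (f p) + TL +o_ 0 id.
  apply/eqaddoP => eps eps0.
  have [eta eta0 etaP] := @expandT `|p| eps eps0.
  near=> v; rewrite /= -[X in `|X|]/(f (v + p) - (f p + T p v)).
  rewrite opprD addrA (addrC v) etaP//.
have dE := diff_unique cTL E.
by split => //; apply/diff_locallyP; rewrite dE.
Unshelve. all: end_near. Qed.

Lemma coord_C1_derive p v : 'D_v f p = \sum_i c i v * 'D_(e i) f p.
Proof. by have [d dE] := T_diff p; rewrite deriveE// dE. Qed.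

Lemma coord_C1_differentiable p : differentiable f p.
Proof. by have [] := T_diff p. Qed.

Lemma coord_C1_expand (M eps : R) : 0 < eps -> exists2 eta : R, 0 < eta & forall p v,
  `|p| <= M -> `|v| <= eta -> `|f (p + v) - f p - 'D_v f p| <= eps * `|v|.
Proof.
move=> eps0; have [eta eta0 H] := @expandT M eps eps0.
by exists eta => // p v pM vM; rewrite coord_C1_derive; exact: H.
Qed.

Lemma coord_C1_derive_bound (M : R) : exists2 B : R, 0 <= B & forall p v,
  `|p| <= M -> `|'D_v f p| <= B * `|v|.
Proof.
have [C cC CM] := cK M.
have [_ [_ cDf]] := f1.
have H i : exists B : R, 0 <= B /\ forall p, C p -> `|'D_(e i) f p| <= B.
  have [cDi _] := cDf (e i).
  by have [B B0 BP] := compact_continuous_bounded cC cDi; exists B.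
have /choice[b /all_and2[b0 bP]] := H.
exists (\sum_i b i); first exact: sumr_ge0.
move=> p v pM; rewrite coord_C1_derive (le_trans (T_bound p v))// ler_wpM2r//.
by apply: ler_sum => i _; apply: bP; exact: CM.
Qed.

Lemma coord_C1_derive_continuous (X : topologicalType) (p v : X -> V) :
  continuous p -> continuous v -> continuous (fun x => 'D_(v x) f (p x)).
Proof.
move=> cp cv; under eq_fun do rewrite coord_C1_derive.
have [_ [_ cDf]] := f1.
apply: continuous_bigsum => i x; apply: cvgM; last first.
  by have [cDi _] := cDf (e i); exact: (continuous_comp (cp x) (cDi (p x))).
have cci : {for v x, continuous (c i)}; last exact: (continuous_comp (cv x) cci).
apply/cvgrPdist_le => eps eps0; near=> w.
have -> : c i (v x) - c i w = c i (v x - w).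
  have c0 : c i 0 = 0 by have := cl i 1 0 0; rewrite scale1r addr0 mul1r => /eqP; rewrite -subr_eq0 opprD addrA subrr sub0r oppr_eq0 => /eqP.
  have := cl i (-1) w (v x); rewrite scaleN1r addrC => ->; ring.
apply: le_trans (cn _ _) _.
by near: w; exact: (@cvgr_dist_le _ _ _ (nbhs (v x)) _ id).
Unshelve. all: end_near. Qed.

End C1.

Section C1_findim.
Context {R : realType} {V : normedModType R}.
Hypothesis fV : findim V.
Variable f : V -> R.
Hypothesis f1 : Ck 1 f.

Lemma C1_differentiable p : differentiable f p.
Proof. by have [[I [e [c [ce cn cl]]]] cK] := fV; exact: coord_C1_differentiable. Qed.

Lemma C1_expand (M eps : R) : 0 < eps -> exists2 eta : R, 0 < eta & forall p v,
  `|p| <= M -> `|v| <= eta -> `|f (p + v) - f p - 'D_v f p| <= eps * `|v|.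
Proof. by have [[I [e [c [ce cn cl]]]] cK] := fV; exact: coord_C1_expand. Qed.

Lemma C1_derive_bound (M : R) : exists2 B : R, 0 <= B & forall p v,
  `|p| <= M -> `|'D_v f p| <= B * `|v|.
Proof. by have [[I [e [c [ce cn cl]]]] cK] := fV; exact: coord_C1_derive_bound. Qed.

Lemma C1_derive_continuous (X : topologicalType) (p v : X -> V) :
  continuous p -> continuous v -> continuous (fun x => 'D_(v x) f (p x)).
Proof. by have [[I [e [c [ce cn cl]]]] cK] := fV; exact: coord_C1_derive_continuous. Qed.

Lemma C1_derive_linear p (a : R) u v :
  'D_(a *: u + v) f p = a * 'D_u f p + 'D_v f p.
Proof. by rewrite !deriveE ?linearP//; exact: C1_differentiable. Qed.

Lemma C1_comp_curve (g : R -> V) (x : R) (dg : V) :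
  is_derive x 1 g dg -> is_derive x 1 (f \o g) ('D_dg f (g x)).
Proof.
move=> [dgx <-].
have /derivable1_diffP dg' := dgx.
have dfg := C1_differentiable (g x).
apply: DeriveDef; first by apply/derivable1_diffP; exact: differentiable_comp.
rewrite deriveE; last exact: differentiable_comp.
by rewrite diff_comp//= -!deriveE.
Qed.

End C1_findim.

(** * First-order expansions with uniform remainder *)

Section Expansion.
Context {R : realType}.

(** The family [dl] is [p + t q + o(t)] as [t] tends to 0, uniformly on [D].  Unlike
pointwise differentiability in [t], this property survives convolution and
integration, and it is obtained without controlling derivatives at nonzero [t]. *)
Definition unif_expand (Z : Type) (V : normedModType R) (D : set Z)
    (dl : R -> Z -> V) (p q : Z -> V) : Prop :=
  forall eps : R, 0 < eps -> exists2 eta : R, 0 < eta & forall t z,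
    D z -> `|t| <= eta -> `|dl t z - p z - t *: q z| <= eps * `|t|.

Lemma unif_expand_cst (Z : Type) (V : normedModType R) (D : set Z) (p : Z -> V) :
  unif_expand D (fun=> p) p (fun=> 0).
Proof.
move=> eps eps0; exists 1 => // t z _ _.
by rewrite scaler0 subr0 subrr normr0 mulr_ge0// ltW.
Qed.

Lemma unif_expand_affine (Z : Type) (V : normedModType R) (D : set Z) (p q : Z -> V) :
  unif_expand D (fun t z => p z + t *: q z) p q.
Proof.
move=> eps eps0; exists 1 => // t z _ _.
by rewrite addrAC addrK subrr normr0 mulr_ge0// ltW.
Qed.

Lemma unif_expand_near0 (Z : Type) (V : normedModType R) (D : set Z) dl (p q : Z -> V)
    (M : R) : 0 <= M ->
  unif_expand D dl p q -> (forall z, D z -> `|q z| <= M) ->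
  exists2 eta : R, 0 < eta & forall t z, D z -> `|t| <= eta ->
    `|dl t z - p z| <= (M + 1) * `|t|.
Proof.
move=> M0 U qM; have [eta eta0 etaP] := U 1 ltr01.
exists eta => // t z Dz te.
rewrite -(subrK (t *: q z) (dl t z - p z)) (le_trans (ler_normD _ _))//.
rewrite mulrDl addrC lerD//; last exact: etaP.
by rewrite normrZ mulrC ler_wpM2r// qM.
Qed.

Lemma unif_expand_sub (Z : Type) (V : normedModType R) (D D' : set Z) dl (p q : Z -> V) :
  D' `<=` D -> unif_expand D dl p q -> unif_expand D' dl p q.
Proof.
move=> DD U eps eps0; have [e e0 eP] := U _ eps0; exists e => // t z Dz te.
by apply: eP => //; exact: DD.
Qed.

Lemma unif_expand_sum (Z : Type) (D : set Z) (I : Type) (r : seq I)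
    (dl : I -> R -> Z -> R) (p q : I -> Z -> R) :
  (forall i, unif_expand D (dl i) (p i) (q i)) ->
  unif_expand D (fun t z => \sum_(i <- r) dl i t z) (fun z => \sum_(i <- r) p i z)
    (fun z => \sum_(i <- r) q i z).
Proof.
move=> U; elim: r => [|i r IH] eps eps0.
  by exists 1 => // t z _ _; rewrite !big_nil scaler0 !subr0 normr0 mulr_ge0// ltW.
have e20 : 0 < eps / 2 by rewrite divr_gt0.
have [e1 e10 P1] := U i _ e20; have [e2 e20' P2] := IH _ e20.
exists (Num.min e1 e2); first by rewrite lt_min e10.
move=> t z Dz; rewrite le_min => /andP[t1 t2]; rewrite !big_cons.
rewrite [X in `|X|](_ : _ = (dl i t z - p i z - t *: q i z) +
   (\sum_(j <- r) dl j t z - \sum_(j <- r) p j z - t *: \sum_(j <- r) q j z)).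
  by rewrite (le_trans (ler_normD _ _))// (splitr eps) mulrDl lerD// ?P1 ?P2.
by rewrite /GRing.scale/=; ring.
Qed.

(** Chain rule.  The bounds on [p] and [q] keep the points in a ball, on which the
remainder of [f] is uniform. *)
Lemma unif_expand_C1 (Z : Type) (V : normedModType R) (D : set Z) dl (p q : Z -> V)
    (f : V -> R) (M : R) :
  findim V -> Ck 1 f ->
  unif_expand D dl p q -> (forall z, D z -> `|p z| <= M) ->
  (forall z, D z -> `|q z| <= M) ->
  unif_expand D (fun t z => f (dl t z)) (f \o p) (fun z => 'D_(q z) f (p z)).
Proof.
move=> fV f1 U pM qM eps eps0.
set M' := `|M|.
have pM' z : D z -> `|p z| <= M' by move=> /pM/le_trans; apply; exact: ler_norm.
have qM' z : D z -> `|q z| <= M' by move=> /qM/le_trans; apply; exact: ler_norm.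
have M'0 : 0 <= M' by exact: normr_ge0.
have [B B0 BP] := C1_derive_bound fV f1 M'.
have [eta1 eta10 P1] := unif_expand_near0 M'0 U qM'.
have e20 : 0 < eps / 2 by rewrite divr_gt0.
have [eta2 eta20 P2] := C1_expand fV f1 M' (divr_gt0 e20 (ltr_wpDl M'0 ltr01)).
have [eta3 eta30 P3] := U _ (divr_gt0 e20 (ltr_wpDl B0 ltr01)).
exists (Num.min (Num.min eta1 (eta2 / (M' + 1))) eta3).
  by rewrite !lt_min eta10 eta30 divr_gt0// ltr_wpDl.
move=> t z Dz; rewrite !le_min => /andP[/andP[t1 t2] t3].
have d1 := P1 _ _ Dz t1.
have d2 : `|dl t z - p z| <= eta2.
  by rewrite (le_trans d1)// mulrC -ler_pdivlMr// ltr_wpDl.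
have := P2 _ _ (pM' _ Dz) d2.
rewrite [p z + _]addrC subrK => P2'.
rewrite /= -(subrK ('D_(dl t z - p z) f (p z)) (f (dl t z) - f (p z))) -addrA.
rewrite (le_trans (ler_normD _ _))// (splitr eps) mulrDl lerD//.
  rewrite (le_trans P2')// -mulrA ler_wpM2l ?(ltW e20)//.
  by rewrite mulrC ler_pdivrMr ?ltr_wpDl// mulrC.
have -> : 'D_(dl t z - p z) f (p z) - t *: 'D_(q z) f (p z) =
          'D_(dl t z - p z - t *: q z) f (p z).
  rewrite (_ : dl t z - p z - t *: q z = (- t) *: q z + (dl t z - p z)); last first.
    by rewrite scaleNr addrC.
  rewrite C1_derive_linear//.
  by rewrite mulNr addrC.
rewrite (le_trans (BP _ _ (pM' _ Dz)))//.
rewrite (le_trans (ler_wpM2l B0 (P3 _ _ Dz t3)))//.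
rewrite -mulrA mulrCA ler_wpM2l ?(ltW e20)// mulrA ler_piMl//.
by rewrite ler_pdivrMr ?ltr_wpDl// mul1r lerDl.
Qed.

Lemma unif_expand_pair (Z : Type) (V W : normedModType R) (D : set Z)
    dl (p q : Z -> V) dl' (p' q' : Z -> W) :
  unif_expand D dl p q -> unif_expand D dl' p' q' ->
  unif_expand D (fun t z => (dl t z, dl' t z)) (fun z => (p z, p' z))
    (fun z => (q z, q' z)).
Proof.
move=> U U' eps eps0; have [e1 e10 P1] := U _ eps0.
have [e2 e20 P2] := U' _ eps0.
exists (Num.min e1 e2); first by rewrite lt_min e10.
move=> t z Dz; rewrite le_min => /andP[t1 t2].
by rewrite prod_normE ge_max P1//= P2.
Qed.

Lemma unif_expand_mx (Z : Type) (D : set Z) m n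
    (dl : R -> Z -> 'M[R]_(m, n)) (p q : Z -> 'M[R]_(m, n)) :
  (forall i j, unif_expand D (fun t z => dl t z i j : R) (fun z => p z i j)
     (fun z => q z i j)) -> unif_expand D dl p q.
Proof.
move=> U eps eps0.
have /choice[e /all_and2[e0 eP]] : forall ij : 'I_m * 'I_n, exists e : R, 0 < e /\
    forall t z, D z -> `|t| <= e ->
    `|dl t z ij.1 ij.2 - p z ij.1 ij.2 - t * q z ij.1 ij.2| <= eps * `|t|.
  by move=> [i j]; have [e e0 eP] := U i j _ eps0; exists e.
exists (\big[Num.min/1]_ij e ij).
  by apply: lt_bigmin => // ij _; exact: e0.
move=> t z Dz te; apply/mx_norm_leP; first by rewrite mulr_ge0// ltW.
move=> i j; rewrite !mxE; apply: (eP (i, j)) => //.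
by rewrite (le_trans te)//; exact: (bigmin_le _ (i, j)).
Qed.

Lemma norm_mulmx_le m n k (A : 'M[R]_(m, n)) (B : 'M[R]_(n, k)) :
  `|A *m B| <= n%:R * `|A| * `|B|.
Proof.
apply/mx_norm_leP; first by rewrite !mulr_ge0.
move=> i j; rewrite mxE (le_trans (ler_norm_sum _ _ _))//.
apply: (@le_trans _ _ (\sum_(l < n) `|A| * `|B|)).
  by apply: ler_sum => l _; rewrite normrM ler_pM// mx_entry_le.
by rewrite sumr_const card_ord -[leLHS]mulr_natl mulrA.
Qed.

Lemma unif_expand_mulmx (Z : Type) (D : set Z) m n k
    (dl : R -> Z -> 'M[R]_(m, n)) (p q : Z -> 'M[R]_(m, n))
    (dl' : R -> Z -> 'M[R]_(n, k)) (p' q' : Z -> 'M[R]_(n, k)) (M : R) :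
  unif_expand D dl p q -> unif_expand D dl' p' q' ->
  (forall z, D z -> [/\ `|p z| <= M, `|q z| <= M, `|p' z| <= M & `|q' z| <= M]) ->
  unif_expand D (fun t z => dl t z *m dl' t z) (fun z => p z *m p' z)
    (fun z => q z *m p' z + p z *m q' z).
Proof.
move=> U U' PM eps eps0.
set M' := `|M|.
have M'0 : 0 <= M' by exact: normr_ge0.
have {}PM z : D z -> [/\ `|p z| <= M', `|q z| <= M', `|p' z| <= M' & `|q' z| <= M'].
  by move=> /PM[? ? ? ?]; split; apply: (le_trans _ (ler_norm _)).
pose C := n%:R * (M' + M' + 1 + (M' + M') + M' * M') + 1.
have C0 : 0 < C by rewrite ltr_wpDl// !mulr_ge0// !addr_ge0// mulr_ge0.
have eC0 : 0 < eps / C by rewrite divr_gt0.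
have [e1 e10 P1] := U _ eC0.
have [e2 e20 P2] := U' _ eC0.
have [e3 e30 P3] := U' 1 ltr01.
exists (Num.min (Num.min e1 e2) (Num.min (Num.min e3 1) (eps / C))).
  by rewrite !lt_min e10 e20 e30 ltr01.
move=> t z Dz; rewrite !le_min => /andP[/andP[t1 t2] /andP[/andP[t3 t4] t5]].
have {P1} := P1 _ _ Dz t1; have {P2} := P2 _ _ Dz t2; have {P3} := P3 _ _ Dz t3.
have [] := PM _ Dz.
move: (dl t z) (dl' t z) (p z) (q z) (p' z) (q' z) => a b x y x' y' xM yM x'M y'M.
set r1 := a - x - t *: y; set r2 := b - x' - t *: y' => r2le' r2le r1le.
have Ea : a = x + t *: y + r1 by rewrite /r1 -[a - x - _]addrA -opprD [RHS]addrC subrK.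
have Eb : b = x' + t *: y' + r2 by rewrite /r2 -[b - x' - _]addrA -opprD [RHS]addrC subrK.
clearbody r1 r2.
have -> : a *m b - x *m x' - t *: (y *m x' + x *m y') =
    r1 *m b + (x + t *: y) *m r2 + (t * t) *: (y *m y').
  rewrite {1}Ea mulmxDl addrC -!addrA.
  rewrite {1}Eb mulmxDr mulmxDl !mulmxDr -!scalemxAl -!scalemxAr scalerDr !scalerA.
  set A := x *m x'; set A1 := x *m y'; set A2 := y *m x'; set A3 := y *m y'.
  set A4 := _ *m r2; set A5 := r1 *m b.
  rewrite !opprD; move: A A1 A2 A3 A4 A5 => A A1 A2 A3 A4 A5.
  apply/matrixP => i j; rewrite !mxE; ring.
have bM : `|b| <= M' + M' + 1.
  rewrite Eb (le_trans (ler_normD _ _))//.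
  rewrite lerD//; last by rewrite (le_trans r2le')// mul1r.
  rewrite (le_trans (ler_normD _ _))// lerD// normrZ.
  by rewrite (le_trans (ler_wpM2l _ y'M))// ler_piMl.
have xyM : `|x + t *: y| <= M' + M'.
  rewrite (le_trans (ler_normD _ _))// lerD// normrZ.
  by rewrite (le_trans (ler_wpM2l _ yM))// ler_piMl.
apply: (@le_trans _ _ (n%:R * `|r1| * `|b| + n%:R * `|x + t *: y| * `|r2| +
    `|t| * `|t| * (n%:R * `|y| * `|y'|))).
  rewrite (le_trans (ler_normD _ _))// lerD//.
    by rewrite (le_trans (ler_normD _ _))// lerD// norm_mulmx_le.
  by rewrite normrZ normrM ler_wpM2l ?mulr_ge0// norm_mulmx_le.
have d0 : 0 <= eps / C * `|t| by rewrite mulr_ge0// ltW.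
apply: (@le_trans _ _ (eps / C * `|t| * C)); last first.
  by rewrite mulrAC divfK ?gt_eqF.
apply: (@le_trans _ _ (eps / C * `|t| * (n%:R * (M' + M' + 1 + (M' + M') + M' * M'))));
  last by rewrite ler_wpM2l// lerDl.
set d := eps / C * `|t| in d0 r1le r2le *.
have h1 : `|r1| * `|b| <= d * (M' + M' + 1) by rewrite ler_pM.
have h2 : `|x + t *: y| * `|r2| <= (M' + M') * d by rewrite ler_pM.
have h3 : `|t| * `|t| * (`|y| * `|y'|) <= d * (M' * M').
  by rewrite ler_pM// ?mulr_ge0// ?ler_pM// ler_wpM2r.
rewrite [leLHS](_ : _ = n%:R * (`|r1| * `|b| + `|x + t *: y| * `|r2|
  + `|t| * `|t| * (`|y| * `|y'|))); last by ring.
rewrite [leRHS](_ : _ = n%:R * (d * (M' + M' + 1) + (M' + M') * d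
  + d * (M' * M'))); last by ring.
by rewrite ler_wpM2l// lerD// lerD.
Qed.

(** Evaluating the expansion at [t = 0] forces [dl 0 z = p z], so the family is
differentiable at 0 with derivative [q z]. *)
Lemma unif_expand_is_derive (Z : Type) (V : normedModType R) (D : set Z) dl (p q : Z -> V) z :
  unif_expand D dl p q -> D z -> is_derive (0 : R) (1 : R) (fun t => dl t z) (q z).
Proof.
move=> U Dz.
have p0 : dl 0 z = p z.
  have [e e0 P] := U 1 ltr01.
  have := P 0 z Dz; rewrite normr0 => /(_ (ltW e0)).
  by rewrite scale0r subr0 mulr0 normr_le0 subr_eq0 => /eqP.
suff cv : h^-1 *: (((fun t : R => dl t z) \o shift 0) (h *: (1 : R)) - dl 0 z)
     @[h --> (0 : R)^'] --> q z.
  by split; [apply/cvg_ex; exists (q z)|exact/cvg_lim].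
apply/cvgrPdist_le => eps eps0; have [eta eta0 etaP] := U _ eps0.
near=> h.
have h0 : h != 0 by near: h; exact: nbhs_dnbhs_neq.
rewrite /= addr0 [h *: 1]mulr1 p0.
have -> : q z - h^-1 *: (dl h z - p z) = - h^-1 *: (dl h z - p z - h *: q z).
  by rewrite [in RHS]scalerBr scalerA mulNr mulVf// scaleN1r opprK addrC scaleNr.
rewrite normrZ normrN normfV mulrC ler_pdivrMr ?normr_gt0//.
by apply: etaP => //; near: h; exact: dnbhs0_le.
Unshelve. all: end_near. Qed.

(** A single derivative is an expansion over a one-point set; the factor [c] may
vanish. *)
Lemma unif_expand_shift (V : normedModType R) (u : R -> V) (x c : R) (du : V) :
  is_derive x 1 u du ->
  unif_expand [set: unit] (fun t _ => u (x + t * c)) (fun=> u x) (fun=> c *: du).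
Proof.
move=> [du1 du2] eps eps0.
have : h^-1 *: ((u \o shift x) (h *: (1 : R)) - u x) @[h --> (0 : R)^'] --> du.
  by rewrite -du2; exact: du1.
have ec0 : 0 < eps / (`|c| + 1) by rewrite divr_gt0// ltr_wpDl.
move=> /cvgrPdist_le/(_ _ ec0)/nbhs_ballP[r /= r0 rP].
exists (r / (`|c| + 1) / 2); first by rewrite !divr_gt0// ltr_wpDl.
move=> t _ _ te; have [tc0|tc0] := eqVneq (t * c) 0.
  by rewrite scalerA tc0 scale0r addr0 !subrr normr0 mulr_ge0// ltW.
have c10 : 0 < `|c| + 1 by rewrite ltr_wpDl.
have tcr : `|t * c| < r.
  rewrite normrM (le_lt_trans (ler_wpM2r _ te))//.
  rewrite mulrAC ltr_pdivrMr// mulrAC ltr_pdivrMr// -mulrA ltr_pM2l//.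
  by rewrite mulr2n mulrDl mul1r ltr_wpDl// ltrDl.
have := rP (t * c); rewrite /ball/= sub0r normrN => /(_ tcr tc0).
rewrite [_ *: 1]mulr1 [t * c + x]addrC => H.
have -> : u (x + t * c) - u x - t *: (c *: du) =
    - ((t * c) *: (du - (t * c)^-1 *: (u (x + t * c) - u x))).
  by rewrite scalerBr !scalerA divff// scale1r opprB.
rewrite normrN normrZ (le_trans (ler_wpM2l _ H))// normrM.
rewrite [leLHS](_ : _ = eps * `|t| * (`|c| / (`|c| + 1))); last by ring.
rewrite ler_piMr ?mulr_ge0// ?(ltW eps0)//.
by rewrite ler_pdivrMr// mul1r lerDl.
Qed.

Lemma Ck_entry (V : normedModType R) m n k (f : V -> 'M[R]_(m, n)) i j :
  Ck k f -> Ck k (fun x => f x i j : R).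
Proof.
elim: k f => [|k IH] f /= [cf H]; split.
- move=> x; exact: (continuous_comp (cf x) (differentiable_continuous (differentiable_coord _ i j))).
- by [].
- move=> x; exact: (continuous_comp (cf x) (differentiable_continuous (differentiable_coord _ i j))).
case: H => df cdf; split; first by move=> x v; have /derivable_mxP := df x v.
move=> v; have := IH _ (cdf v); congr Ck.
by apply/funext => x; rewrite derive_mx// mxE.
Qed.

Lemma Ck_le (V W : normedModType R) k l (f : V -> W) : (k <= l)%N -> Ck l f -> Ck k f.
Proof.
elim: l k f => [|l IH] [|k] f //=; first by move=> _ [].
by rewrite ltnS => kl [cf [df cdf]]; split => //; split => // v; exact: IH.
Qed.

End Expansion.

(** * The matrix exponential and the infinitesimal action *)

(** With this instance, absolutely convergent series of matrices converge. *)
HB.instance Definition _ (R : realType) m n := Complete.on 'M[R]_(m, n).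

Section Expmx.
Context {R : realType} {d : nat}.
Implicit Types X : 'M[R]_d.

Lemma norm_expr_mx_le X k : `|X ^+ k| <= (d%:R * `|X|) ^+ k.
Proof.
elim: k => [|k IH].
  rewrite !expr0; apply/mx_norm_leP => // i j; rewrite mxE.
  by case: eqP; rewrite ?normr1 ?normr0.
rewrite !exprS (le_trans (norm_mulmx_le _ _))// ler_wpM2l// mulr_ge0//.
Qed.

Let c X := d%:R * `|X|.
Let term X := fun k : nat => (k`!%:R)^-1 *: X ^+ k.

Lemma norm_term_le X k : `|term X k| <= exp_coeff (c X) k.
Proof.
rewrite /term /exp_coeff/= normrZ ger0_norm ?invr_ge0// mulrC.
by rewrite ler_wpM2r ?invr_ge0// norm_expr_mx_le.
Qed.

Lemma expmx_cvg X : cvgn (series (term X)).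
Proof.
apply: normed_cvg; apply: (@series_le_cvg _ _ (exp_coeff (c X))) => /=.
- by move=> n; exact: normr_ge0.
- by move=> n; apply: exp_coeff_ge0; rewrite mulr_ge0.
- by move=> n; exact: norm_term_le.
- exact: is_cvg_series_exp_coeff.
Qed.

(** For [|t| <= 1] each term of order at least 2 is at most [t ^ 2] times the
corresponding term of the scalar exponential series at [d |X|]; the factor [d] makes
the norm submultiplicative. *)
Lemma expmx_remainder X (t : R) : `|t| <= 1 ->
  `|expmx (t *: X) - 1%:M - t *: X| <= expR (d%:R * `|X|) * (t * t).
Proof.
move=> t1; rewrite -/(c X).
have cX0 : 0 <= c X by rewrite /c mulr_ge0.
have lim_cvg : series (term (t *: X)) n - 1%:M - t *: X @[n --> \oo] -->
    expmx (t *: X) - 1%:M - t *: X.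
  by apply: cvgB; [apply: cvgB; [exact: expmx_cvg|exact: cvg_cst]|exact: cvg_cst].
have /cvg_norm lim_cvg' := lim_cvg.
rewrite -(cvg_lim _ lim_cvg')//.
apply: limr_le; first by apply/cvg_ex; eexists; exact: lim_cvg'.
near=> n.
have n2 : (1 < n)%N by near: n; exact: nbhs_infty_gt.
(* The terms of order 0 and 1 are exactly the ones that are subtracted. *)
rewrite /series/= (big_cat_nat _ (n := 2))//= big_nat_recl// big_nat1.
rewrite /term fact0 expr0 invr1 scale1r expr1 scale1r.
have -> : forall A B C : 'M[R]_d, A + B + C - A - B = C.
  by move=> A B C; rewrite -[LHS]addrA -opprD addrAC subrr add0r.
rewrite (le_trans (ler_norm_sum _ _ _))//.
have tt : `|t| ^+ 2 = t * t by rewrite real_normK ?num_real// expr2.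
apply: (@le_trans _ _ (\sum_(2 <= k < n) t * t * exp_coeff (c X) k)).
  rewrite big_nat_cond [leRHS]big_nat_cond; apply: ler_sum => k.
  rewrite andbT => /andP[k2 _].
  rewrite (le_trans (norm_term_le (t *: X) k))// /exp_coeff/= /c normrZ.
  rewrite mulrCA exprMn mulrA -/(c X) -[leRHS]mulrA -[leLHS]mulrA.
  rewrite -tt ler_wpM2r// ?mulr_ge0// ?exprn_ge0// ?invr_ge0//.
  by rewrite -(subnK k2) exprD ler_piMl ?exprn_ge0// exprn_ile1.
rewrite -mulr_sumr mulrC ler_wpM2r//; first by rewrite -expr2 sqr_ge0.
have e0 k : 0 <= exp_coeff (c X) k by exact: exp_coeff_ge0.
apply: (@le_trans _ _ (series (exp_coeff (c X)) n)).
  rewrite /series/= [leRHS](big_cat_nat _ (n := 2))//= lerDr sumr_ge0//.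
apply: nondecreasing_cvgn_le; last exact: is_cvg_series_exp_coeff.
by apply/nondecreasing_seqP => k; rewrite /series/= big_nat_recr//= lerDl.
Unshelve. all: end_near. Qed.

Lemma unif_expand_expmx (Z : Type) (D : set Z) X :
  unif_expand D (fun t _ => expmx (t *: X)) (fun=> 1%:M) (fun=> X).
Proof.
move=> eps eps0.
have E0 : 0 < expR (d%:R * `|X|) by exact: expR_gt0.
exists (Num.min 1 (eps / expR (d%:R * `|X|))); first by rewrite lt_min ltr01 divr_gt0.
move=> t z _; rewrite le_min => /andP[t1 te].
rewrite (le_trans (expmx_remainder X t1))//.
have -> : t * t = `|t| * `|t| by rewrite -expr2 -[LHS]real_normK ?num_real// expr2.
rewrite mulrA ler_wpM2r// mulrC -ler_pdivlMr//.
Qed.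

(** Product rule for [exp(s X) u(x + s t)] at [s = 0]. *)
Lemma inf_funE (xi : 'M[R]_d * R) (u : R -> 'cV[R]_d) (x : R) :
  derivable u x 1 -> inf_fun xi u x = xi.1 *m u x + xi.2 *: 'D_1 u x.
Proof.
move=> du; rewrite /inf_fun derive1E.
have U1 : unif_expand [set: unit] (fun t _ => expmx (t *: xi.1)) (fun=> 1%:M) (fun=> xi.1).
  exact: unif_expand_expmx.
have U2 := @unif_expand_shift R _ u x xi.2 _ (derivableP du).
set M := `|1%:M : 'M[R]_d| + `|xi.1| + `|u x| + `|xi.2 *: 'D_1 u x|.
have M0 : [/\ `|1%:M : 'M[R]_d| <= M, `|xi.1| <= M, `|u x| <= M & `|xi.2 *: 'D_1 u x| <= M].
  rewrite /M; split; have := normr_ge0 (1%:M : 'M[R]_d); have := normr_ge0 xi.1;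
    have := normr_ge0 (u x); have := normr_ge0 (xi.2 *: 'D_1 u x); lra.
have U := unif_expand_mulmx U1 U2 (fun _ _ => M0).
by have [_ /=] := unif_expand_is_derive (z := tt) U I; rewrite mul1mx.
Qed.

Lemma inf_oneE (xi : 'M[R]_d * R) : inf_one xi = - xi.2.
Proof.
rewrite /inf_one /act_pt /gexp/= derive1E.
have -> : (fun t : R => 1 - t * xi.2) = (cst 1 : R -> R) - xi.2 *: id.
  by apply/funext => t; rewrite !fctE mulrC.
by rewrite deriveB// derive_cst deriveZ// derive_id sub0r [_ *: 1]mulr1.
Qed.

End Expmx.

(** * Measure-preserving changes of variables *)

Section MeasurePreserving.
Context {disp : measure_display} {T : measurableType disp} {R : realType}.
Variable mu : {measure set T -> \bar R}.
Variable phi : T -> T.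
Hypothesis mphi : measurable_fun [set: T] phi.
Hypothesis phi_mu : forall A, measurable A -> mu (phi @^-1` A) = mu A.

Lemma integrable_preserving (f : T -> \bar R) :
  mu.-integrable [set: T] f -> mu.-integrable [set: T] (f \o phi).
Proof.
move=> /integrableP[mf foo]; apply/integrableP; split.
  exact: (measurableT_comp mf mphi).
rewrite -[X in (\int[_]_(_ in X) _ < _)%E](preimage_setT phi).
rewrite -(@ge0_integral_pushforward _ _ _ _ _ _ mphi mu _ (fun x => `|f x|)%E)//; last first.
  by apply: measurableT_comp.
rewrite [ltLHS](_ : _ = (\int[mu]_x `|f x|)%E)//.
by apply: eq_measure_integral => A mA _; exact: phi_mu.
Qed.

Lemma Rintegral_preserving (f : T -> R) :
  mu.-integrable [set: T] (EFin \o f) ->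
  \int[mu]_x f (phi x) = \int[mu]_x f x.
Proof.
move=> intf; have := intf => /integrableP[mf _].
have intfphi := integrable_preserving intf.
rewrite /Rintegral; congr fine.
rewrite -[X in (\int[_]_(_ in X) _)%E = _](preimage_setT phi).
rewrite -(@integral_pushforward _ _ _ _ _ _ mphi mu _ (EFin \o f))//.
by apply: eq_measure_integral => A mA _; exact: phi_mu.
Qed.

Lemma ge0_integral_preserving (f : T -> \bar R) :
  measurable_fun [set: T] f -> (forall x, 0 <= f x)%E ->
  (\int[mu]_x f (phi x) = \int[mu]_x f x)%E.
Proof.
move=> mf f0.
rewrite -[X in (\int[_]_(_ in X) _)%E = _](preimage_setT phi).
rewrite -(@ge0_integral_pushforward _ _ _ _ _ _ mphi mu _ f)//.
by apply: eq_measure_integral => A mA _; exact: phi_mu.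
Qed.

End MeasurePreserving.

Section Lebesgue.
Context {R : realType}.
Notation mu := (@lebesgue_measure R).

Lemma measurable_shift (a : R) : measurable_fun [set: R] (fun x : R => x + a).
Proof. exact: measurable_funD. Qed.

Lemma lebesgue_shift (a : R) (A : set R) : measurable A ->
  mu ((fun x : R => x + a) @^-1` A) = mu A.
Proof.
move=> mA; change (pushforward mu (fun x : measurableTypeR R => x + a : measurableTypeR R) A = mu A).
apply/esym/lebesgue_measure_unique => //=.
  exact: measurable_shift.
move=> m _ [[x y]] _ <-.
rewrite /pushforward (_ : _ @^-1` _ = `]x - a, y - a]%classic); last first.
  by apply/seteqP; split => z /=; rewrite !in_itv/= ltrBlDr lerBrDr.
by rewrite !lebesgue_measure_itv/= !lte_fin ltrD2r -!EFinB opprB addrA subrK.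
Qed.

Lemma measurable_reflect (a : R) : measurable_fun [set: R] (fun x : R => a - x).
Proof. exact: measurable_funB. Qed.

Lemma lebesgue_reflect (a : R) (A : set R) : measurable A ->
  mu ((fun x : R => a - x) @^-1` A) = mu A.
Proof.
move=> mA.
rewrite -[RHS](lebesgue_shift a mA) -[RHS]lebesgue_measureN.
  by rewrite /pushforward; congr (mu _); apply/seteqP; split => x /=; rewrite addrC.
by rewrite -[X in measurable X]setTI; exact: (measurable_shift a).
Qed.

Notation mu2 := (@lebesgue_measure R \x @lebesgue_measure R)%E.

Lemma measurable_shift2 (a : R) :
  measurable_fun [set: R * R] (fun p : R * R => (p.1 + a, p.2 + a)).
Proof.
by apply/measurable_fun_pairP; split; apply: measurable_funD.
Qed.

Lemma lebesgue2_shift (a : R) (A : set (R * R)) : measurable A ->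
  mu2 ((fun p : R * R => (p.1 + a, p.2 + a)) @^-1` A) = mu2 A.
Proof.
move=> mA; change (pushforward mu2 (fun p : measurableTypeR R * measurableTypeR R =>
  (p.1 + a, p.2 + a) : measurableTypeR R * measurableTypeR R) A = mu2 A).
apply/esym/product_measure_unique => //=.
  exact: measurable_shift2.
move=> m X Y mX mY.
rewrite /pushforward (_ : _ @^-1` _ =
  ((fun x : R => x + a) @^-1` X) `*` ((fun x : R => x + a) @^-1` Y))//.
rewrite product_measure1E/=.
- by rewrite !lebesgue_shift.
- by rewrite -[X in measurable X]setTI; exact: (measurable_shift a).
- by rewrite -[X in measurable X]setTI; exact: (measurable_shift a).
Qed.

Lemma measurable_swap2 : measurable_fun [set: R * R] (fun p : R * R => (p.2, p.1)).
Proof. exact: measurable_fun_pair. Qed.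

Lemma lebesgue2_swap (A : set (R * R)) : measurable A ->
  mu2 ((fun p : R * R => (p.2, p.1)) @^-1` A) = mu2 A.
Proof.
move=> mA; change (pushforward mu2 (fun p : measurableTypeR R * measurableTypeR R =>
  (p.2, p.1) : measurableTypeR R * measurableTypeR R) A = mu2 A).
apply/esym/product_measure_unique => //=.
  exact: measurable_swap2.
move=> m X Y mX mY.
rewrite /pushforward (_ : _ @^-1` _ = Y `*` X).
  by rewrite product_measure1E//= muleC.
by apply/seteqP; split => -[x y] /= [].
Qed.

End Lebesgue.

(** * Kernels of a difference on subsets of the plane *)

Section PlaneKernels.
Context {R : realType}.
Notation mu := (@lebesgue_measure R).
Notation mu2 := (@lebesgue_measure R \x @lebesgue_measure R)%E.

Lemma quadrantE : @quadrant R = `]-oo, 0[ `*` `]0, +oo[.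
Proof. by apply/seteqP; split => -[x y] /=; rewrite !in_itv/= andbT. Qed.

Lemma measurable_quadrant : measurable (@quadrant R).
Proof. by rewrite quadrantE; apply: measurableX; exact: measurable_itv. Qed.

(** In the variables [x] and [z = x - y], the quadrant is [z < x < 0], whose section at
fixed [z] has length [|z|]: Tonelli bounds the integral by the first moment of the
kernel. *)
Lemma integrable_quadrant_kernel (k : R -> R) :
  measurable_fun [set: R] k ->
  mu.-integrable [set: R] (fun r => (`|r| * `|k r|)%:E) ->
  mu2.-integrable (@quadrant R) (fun p => (k (p.1 - p.2))%:E).
Proof.
move=> mk ik.
pose A : set (R * R) := [set p | p.1 < 0] `&` [set p | 0 < p.1 - p.2].
have mA : measurable A.
  apply: measurableI.
    rewrite (_ : [set _ | _] = `]-oo, 0[ `*` setT).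
      by apply: measurableX => //; exact: measurable_itv.
    by apply/seteqP; split => -[x y] /=; rewrite in_itv/=; [|case].
  rewrite (_ : [set _ | _] = [set: R * R] `&` (fun p : R * R => p.1 - p.2) @^-1` `]0, +oo[).
    have : measurable_fun [set: R * R] (fun p : R * R => p.1 - p.2) by exact: measurable_funB.
    by apply => //; exact: measurable_itv.
  by apply/seteqP; split => -[x y] /=; rewrite in_itv/= andbT; [|case].
pose h (p : R * R) : \bar R := (`|k p.2| * \1_A p)%:E.
have mh : measurable_fun [set: R * R] h.
  apply/measurable_EFinP; apply: measurable_funM.
    by apply: measurableT_comp => //; apply: measurableT_comp.
  exact: measurable_indic.
have h0 p : (0 <= h p)%E by rewrite lee_fin mulr_ge0.
apply/(@integrable_mkcond _ _ _ mu2 _ _ measurable_quadrant).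
set g := (_ \_ _).
have mg : measurable_fun [set: R * R] g.
  apply/(measurable_restrictT _ measurable_quadrant).
  apply/measurable_funTS/measurable_EFinP; apply: measurableT_comp => //.
  exact: measurable_funB.
apply/(integrable12ltyP mu mu mg).
have gh (x y : R) : (`|g (x, y)| = h (x, (x - y)%R))%E.
  rewrite /g /h patchE /indic /=.
  have -> : ((x, x - y) \in A) = ((x, y) \in @quadrant R).
    by apply/idP/idP; rewrite !inE /A /quadrant/= subKr.
  by case: (_ \in quadrant); rewrite ?mulr1 ?mulr0 ?abse0.
under eq_integral do under eq_integral do rewrite gh.
rewrite (_ : (\int[mu]_x _)%E = (\int[mu]_x \int[mu]_z h (x, z))%E); last first.
  apply: eq_integral => x _.
  apply: (@ge0_integral_preserving _ _ _ mu (fun y : measurableTypeR R => x - y : measurableTypeR R) _ _ (fun z => h (x, z))) => //.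
  - exact: measurable_reflect.
  - by move=> B mB; exact: lebesgue_reflect.
  - exact: measurable_fun_pair2.
rewrite (fubini_tonelli (m1 := mu) (m2 := mu) h)//.
have := ik => /integrableP[mik]; apply: le_lt_trans.
apply: ge0_le_integral => //.
- by move=> z _; exact: integral_ge0.
- exact: (measurable_fun_fubini_tonelli_G (m1 := mu) h).
- by apply: measurableT_comp.
move=> z _.
rewrite /h /=.
under eq_integral do rewrite EFinM.
rewrite ge0_integralZl//; last first.
  apply: (measurable_fun_pair1 z (f := EFin \o \1_A)).
  by apply/measurable_EFinP; exact: measurable_indic.
rewrite (_ : (fun x : R => (\1_A (x, z))%:E) = (fun x : R => (\1_(`]z, 0[%classic) x)%:E)); last first.
  apply/funext => x; rewrite /indic; congr (_%:R%:E); congr nat_of_bool.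
  apply/idP/idP; rewrite !inE /A/= in_itv/= subr_gt0; first by case=> -> ->.
  by case/andP=> -> ->.
rewrite integral_indic//= setIT lebesgue_measure_itv/= lte_fin normrM normr_id mulrC.
case: ifPn => [z0|_]; last by rewrite mule0 lee_fin !mulr_ge0.
by rewrite -EFinB -EFinM lee_fin sub0r normr_id ler_wpM2l// ler_normr lexx orbT.
Qed.

Lemma measurable_kernel_diff (k : R -> R) : measurable_fun [set: R] k ->
  measurable_fun [set: R * R] (fun p : R * R => k (p.1 - p.2)).
Proof. by move=> mk; apply: measurableT_comp => //; exact: measurable_funB. Qed.

(** By translation each section has at most the mass of [|k|], and the first variable
runs through a bounded interval. *)
Lemma integrable_square_kernel (k : R -> R) (a b : R) :
  mu.-integrable [set: R] (EFin \o k) ->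
  mu2.-integrable (`[a, b] `*` `[a, b]) (fun p => (k (p.1 - p.2))%:E).
Proof.
move=> ik; have /integrableP[/measurable_EFinP mk kfin] := ik.
have mD : measurable (`[a, b] `*` `[a, b] : set (R * R)).
  by apply: measurableX; exact: measurable_itv.
apply/(@integrable_mkcond _ _ _ mu2 _ _ mD).
set g := (_ \_ _).
have mg : measurable_fun [set: R * R] g.
  apply/(measurable_restrictT _ mD)/measurable_funTS/measurable_EFinP.
  exact: measurable_kernel_diff.
apply/(integrable12ltyP mu mu mg).
pose c := (\int[mu]_z `|(k z)%:E|)%E.
have c0 : (0 <= c)%E by exact: integral_ge0.
have inner (x : R) : (\int[mu]_y `|g (x, y)| <= c * (\1_(`[a, b]%classic : set R) x)%:E)%E.
  rewrite indicE; case: (boolP (x \in _)) => xab.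
    rewrite mule1 /c.
    have -> : (\int[mu]_z `|(k z)%:E| = \int[mu]_y `|(k (x - y)%R)%:E|)%E.
      apply: esym; apply: (@ge0_integral_preserving _ _ _ mu
        (fun y : measurableTypeR R => x - y : measurableTypeR R) _ _
        (fun z => `|(k z)%:E|%E)) => //.
      - exact: measurable_reflect.
      - by move=> B mB; exact: lebesgue_reflect.
      - by apply: measurableT_comp => //; exact/measurable_EFinP.
    apply: ge0_le_integral => //.
    - by apply: measurableT_comp => //; exact: measurable_fun_pair2.
    - apply: measurableT_comp => //; apply/measurable_EFinP.
      by apply: measurableT_comp => //; exact: measurable_reflect.
    move=> y _; rewrite /g patchE /=; case: ifP => // _.
    by rewrite abse0 lee_fin.
  rewrite mule0 integral0_eq// => y _; rewrite /g patchE ifF ?abse0//.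
  by apply/negP; rewrite inE/= => -[xab' _]; move/negP: xab; apply; rewrite inE.
apply: (@le_lt_trans _ _ (\int[mu]_x (c * (\1_(`[a, b]%classic : set R) x)%:E))%E).
  apply: ge0_le_integral => //.
  - by move=> x _; exact: integral_ge0.
  - apply: (measurable_fun_fubini_tonelli_F (m2 := mu) (abse \o g)) => //.
    + exact: (measurableT_comp (@abse_measurable R setT) mg).
    + by move=> p; exact: abse_ge0.
  - by apply: measurable_funeM; apply/measurable_EFinP; exact: measurable_indic.
rewrite ge0_integralZl//; last 1 first.
  by apply/measurable_EFinP; exact: measurable_indic.
rewrite integral_indic//= setIT lebesgue_measure_itv/=.
have cf : c \is a fin_num by rewrite ge0_fin_numE.
by case: ifP => _; rewrite ?mule0// -EFinB -(fineK cf) -EFinM ltry.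
Qed.

Lemma integrable_weighted (D : set (R * R)) (k h : R * R -> R) (M : R) :
  measurable D -> mu2.-integrable D (EFin \o k) -> measurable_fun [set: R * R] h ->
  (forall p, D p -> `|h p| <= M) -> mu2.-integrable D (EFin \o (fun p => k p * h p)).
Proof.
move=> mD ik mh hM.
have iM : mu2.-integrable D (fun p => (M%:E * (k p)%:E)%E) by exact: integrableZl.
have /integrableP[/measurable_EFinP mk _] := ik.
apply: le_integrable iM => //.
  by apply/measurable_EFinP; apply: measurable_funM => //; exact: measurable_funTS.
move=> p Dp; rewrite lee_fin mulrC !normrM ler_wpM2r//.
exact: le_trans (hM p Dp) (ler_norm M).
Qed.

End PlaneKernels.

(** * Flux of an antisymmetric density through quadrants *)

Section Flux.
Context {R : realType}.
Notation mu := (@lebesgue_measure R).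
Notation mu2 := (@lebesgue_measure R \x @lebesgue_measure R)%E.

Definition quadrant_at (x : R) : set (R * R) := [set p | p.1 < x /\ x < p.2].

(** Half-open version of the quadrant: it differs from it by a null set and makes
the decomposition in [flux_difference] exact at every point. *)
Let hquad (x : R) : set (R * R) := `]-oo, x[ `*` `[x, +oo[.
Let corner (x : R) : set (R * R) := `]-oo, x[ `*` `]-oo, x[.

Let mem_hquad t x y : ((x, y) \in hquad t) = (x < t) && (t <= y).
Proof.
by apply/idP/idP; rewrite inE /hquad/= !in_itv/= andbT; [case=> -> -> | case/andP=> -> ->].
Qed.

Let mem_corner t x y : ((x, y) \in corner t) = (x < t) && (y < t).
Proof.
by apply/idP/idP; rewrite inE /corner/= !in_itv/=; [case=> -> -> | case/andP=> -> ->].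
Qed.

Let measurable_hquad x : measurable (hquad x).
Proof. by apply: measurableX; exact: measurable_itv. Qed.

Let measurable_corner x : measurable (corner x).
Proof. by apply: measurableX; exact: measurable_itv. Qed.

Let hline (x : R) : set (R * R) := setT `*` [set x].

Let mu2_hline x : mu2 (hline x) = 0%E.
Proof. by rewrite /hline product_measure1E//= lebesgue_measure_set1 mule0. Qed.

Let measurable_hline x : measurable (hline x).
Proof. by apply: measurableX. Qed.

Let hquad_hline x : hquad x `\` hline x = quadrant_at x.
Proof.
rewrite /hquad /hline /quadrant_at; apply/seteqP; split => -[a b] /=; rewrite !in_itv/= andbT.
  move=> [[ax xb] bx]; split => //; rewrite lt_neqAle xb andbT.
  by apply/negP => /eqP xbE; apply: bx.
by move=> [ax xb]; split; [rewrite ax ltW|case=> _ bx; rewrite bx ltxx in xb].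
Qed.

Variable s : R * R -> R.
Hypothesis ms : measurable_fun [set: R * R] s.
Hypothesis antis : forall x y, s (y, x) = - s (x, y).

Let mes (D : set (R * R)) : measurable_fun D (EFin \o s).
Proof. by apply: measurable_funTS; exact/measurable_EFinP. Qed.

Let hquad_integrable x : mu2.-integrable (quadrant_at x) (EFin \o s) ->
  mu2.-integrable (hquad x) (EFin \o s).
Proof.
move=> i; have := @negligible_integrable _ _ _ mu2 (hquad x) (hline x) (EFin \o s)
  (measurable_hline x) (measurable_hquad x).
by rewrite hquad_hline => H; apply/H => //; [exact: mes|exact: mu2_hline].
Qed.

Let hquad_Rintegral x : mu2.-integrable (quadrant_at x) (EFin \o s) ->
  \int[mu2]_(p in quadrant_at x) s p = \int[mu2]_p (s \_ (hquad x)) p.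
Proof.
move=> /hquad_integrable i; rewrite -Rintegral_mkcond -hquad_hline.
by rewrite /Rintegral -(@negligible_integral _ _ _ mu2 (hquad x) (hline x))//;
  [exact: measurable_hline|exact: measurable_hquad|exact: mu2_hline].
Qed.

Let restrict_integrable (D : set (R * R)) : measurable D ->
  mu2.-integrable D (EFin \o s) -> mu2.-integrable [set: R * R] (EFin \o (s \_ D)).
Proof.
by move=> mD /(@integrable_mkcond _ _ _ mu2 _ _ mD); rewrite restrict_EFin.
Qed.

Let restrE (D : set (R * R)) p : (s \_ D) p = if p \in D then s p else 0.
Proof. by rewrite patchE. Qed.

(** With [Y] the region of pairs below [x2] but not both below [x1], the strip
[x1 <= a < x2] is [hquad x2 - hquad x1 + Y] as a combination of indicators.  The
integral over [Y] vanishes by exchange of the coordinates, and Fubini on the strip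
gives the right-hand side. *)
Lemma flux_difference x1 x2 : x1 < x2 ->
  mu2.-integrable (quadrant_at x1) (EFin \o s) ->
  mu2.-integrable (quadrant_at x2) (EFin \o s) ->
  mu2.-integrable (`[x1, x2] `*` `[x1, x2]) (EFin \o s) ->
  (forall a, mu.-integrable [set: R] (fun b => (s (a, b))%:E)) ->
  \int[mu2]_(p in quadrant_at x2) s p - \int[mu2]_(p in quadrant_at x1) s p =
  \int[mu]_(a in `[x1, x2]) \int[mu]_b s (a, b).
Proof.
move=> x12 i1 i2 i3 i4.
pose Y := corner x2 `\` corner x1.
have mY : measurable Y by exact: measurableD.
pose I : set (R * R) := `[x1, x2[ `*` setT.
have mI : measurable I by apply: measurableX => //; exact: measurable_itv.
have mem_I x y : ((x, y) \in I) = (x1 <= x) && (x < x2).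
  by apply/idP/idP; rewrite inE /I/= in_itv/=; [case | move=> ->; split].
have mem_Y x y : ((x, y) \in Y) = ((x < x2) && (y < x2)) && ~~ ((x < x1) && (y < x1)).
  by rewrite in_setD !mem_corner.
have h1 := restrict_integrable (measurable_hquad x1) (hquad_integrable i1).
have h2 := restrict_integrable (measurable_hquad x2) (hquad_integrable i2).
have h3 := restrict_integrable (measurableX (measurable_itv _) (measurable_itv _)) i3.
have h1' : mu2.-integrable [set: R * R] (EFin \o (fun p => (s \_ (hquad x1)) (p.2, p.1))).
  apply: (@integrable_preserving _ _ _ mu2 _ _ _ _ h1).
  - exact: measurable_swap2.
  - by move=> A mA; exact: lebesgue2_swap.
(* [Y] is covered by [hquad x1], its mirror image and the square on [x1, x2]. *)
have hY : mu2.-integrable [set: R * R] (EFin \o (s \_ Y)).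
  pose g p := `|(s \_ (hquad x1)) p| + `|(s \_ (hquad x1)) (p.2, p.1)| +
    `|(s \_ (`[x1, x2] `*` `[x1, x2])) p|.
  have : mu2.-integrable [set: R * R] (EFin \o g).
    rewrite (_ : EFin \o g = (fun p => (`|((s \_ (hquad x1)) p)%:E| +
     `|((s \_ (hquad x1)) (p.2, p.1))%:E| +
     `|((s \_ (`[x1, x2] `*` `[x1, x2])) p)%:E|)%E))//.
    by apply: integrableD => //; [apply: integrableD => //|]; exact: integrable_abse.
  apply: le_integrable => //.
    apply/measurable_EFinP; apply/(measurable_restrictT _ mY).
    exact: measurable_funTS.
  move=> -[x y] _ /=; rewrite lee_fin [leRHS]ger0_norm ?addr_ge0//.
  rewrite /g !restrE /= !mem_hquad mem_Y.
  have -> : ((x, y) \in `[x1, x2] `*` `[x1, x2]) = (x1 <= x <= x2) && (x1 <= y <= x2).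
    by apply/idP/idP; rewrite inE /= !in_itv/=; [case=> -> ->|case/andP].
  rewrite (antis x y).
  case: (ltP x x1) => xx1; case: (ltP y x1) => yx1 /=.
  - by rewrite andbF normr0 !addr_ge0.
  - case: ifP => _; last by rewrite normr0 !addr_ge0.
    by rewrite normr0 addr0 lerDl.
  - case: ifP => _; last by rewrite normr0 !addr_ge0.
    by rewrite normr0 add0r normrN lerDl.
  - case: ifP => [/andP[/andP[xx2 yx2] _]|_]; last by rewrite normr0 !addr_ge0.
    by rewrite (ltW xx2) (ltW yx2)/= lerDr addr_ge0.
have Y0 : \int[mu2]_p (s \_ Y) p = 0.
  have := @Rintegral_preserving _ _ _ mu2 _ measurable_swap2
     (fun A mA => lebesgue2_swap mA) _ hY.
  rewrite (_ : \int[mu2]_p (s \_ Y) (p.2, p.1) = - \int[mu2]_p (s \_ Y) p); last first.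
    have swapY (x y : R) : (s \_ Y) (y, x) = -1 * (s \_ Y) (x, y).
      rewrite !restrE !mem_Y antis [(y < x2) && _]andbC [(y < x1) && _]andbC.
      by case: ifP; rewrite ?mulN1r ?oppr0.
    rewrite -mulN1r -RintegralZl//; congr Rintegral; apply/funext => -[x y].
    exact: swapY.
  lra.
have EI : s \_ I = (fun p => (s \_ (hquad x2)) p - (s \_ (hquad x1)) p + (s \_ Y) p).
  apply/funext => -[x y]; rewrite !restrE mem_I !mem_hquad mem_Y.
  by case: (ltP x x1) => xx1; case: (ltP x x2) => xx2; case: (ltP y x1) => yx1;
    case: (ltP y x2) => yx2 //=; lra.
have h21 : mu2.-integrable [set: R * R]
    (EFin \o (fun p => (s \_ (hquad x2)) p - (s \_ (hquad x1)) p)).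
  exact: (integrableB _ h2 h1).
have hI : mu2.-integrable [set: R * R] (EFin \o (s \_ I)).
  rewrite EI; exact: (integrableD _ h21 hY).
rewrite !hquad_Rintegral//.
have -> : \int[mu2]_p (s \_ (hquad x2)) p - \int[mu2]_p (s \_ (hquad x1)) p =
    \int[mu2]_p (s \_ I) p.
  by rewrite EI RintegralD// Y0 addr0 RintegralB.
have sI a : \int[mu]_b (s \_ I) (a, b) =
    ((fun a => \int[mu]_b s (a, b)) \_ `[x1, x2[) a.
  rewrite patchE; case: ifPn => aI.
    congr Rintegral; apply/funext => b.
    by rewrite restrE mem_I; move: aI; rewrite inE/= in_itv/= => ->.
  rewrite (_ : (fun b => (s \_ I) (a, b)) = cst 0).
    by rewrite Rintegral_cst// mul0r.
  apply/funext => b; rewrite restrE mem_I.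
  by case: ifPn => //; move: aI; rewrite notin_setE/= in_itv/=.
have FE a : fubini_F mu (EFin \o (s \_ I)) a =
    (((fun a => \int[mu]_b s (a, b)) \_ `[x1, x2[) a)%:E.
  rewrite -sI /Rintegral fineK//; apply: integrable_fin_num => //.
  rewrite (_ : (fun b => ((s \_ I) (a, b))%:E) =
    (if a \in `[x1, x2[%classic then fun b => (s (a, b))%:E else cst 0%E)).
    by case: ifP => _; [exact: i4|exact: integrable0].
  apply/funext => b; rewrite restrE mem_I.
  have -> : (a \in `[x1, x2[%classic) = (x1 <= a < x2).
    by apply/idP/idP; rewrite inE/= in_itv/=.
  by case: ifP.
pose F := (fun a => \int[mu]_b s (a, b)) \_ `[x1, x2[.
have {}FE : fubini_F mu (EFin \o (s \_ I)) = EFin \o F by apply/funext => a; exact: FE.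
have hF : mu.-integrable [set: R] (EFin \o F).
  by rewrite -FE; exact: (integrable_fubini_F hI).
have EF : (\int[mu]_a (F a)%:E = \int[mu2]_p ((s \_ I) p)%:E)%E.
  transitivity (\int[mu]_a fubini_F mu (EFin \o (s \_ I)) a)%E; first by rewrite FE.
  exact: (integral12_prod_meas1 hI).
rewrite /Rintegral -EF -[LHS]/(Rintegral _ _ _) -Rintegral_mkcond Rintegral_itv_bndo_bndc//.
apply/(@integrable_mkcond _ _ _ mu _ _ (measurable_itv _)).
by rewrite restrict_EFin.
Qed.

End Flux.

(** * Bounded continuous functions and scalar convolution *)

Section BoundedContinuous.
Context {R : realType}.

Definition bcont (W : normedModType R) (f : R -> W) : Prop :=
  continuous f /\ exists M : R, forall x, `|f x| <= M.

Lemma bcont_cst (W : normedModType R) (w : W) : bcont (fun=> w : W).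
Proof. by split; [exact: cst_continuous|exists `|w|]. Qed.

Lemma bcontD (W : normedModType R) (f g : R -> W) :
  bcont f -> bcont g -> bcont (fun x => f x + g x).
Proof.
move=> [cf [M fM]] [cg [N gN]]; split; first by move=> x; apply: cvgD; [exact: cf|exact: cg].
by exists (M + N) => x; rewrite (le_trans (ler_normD _ _))// lerD.
Qed.

Lemma bcontB (W : normedModType R) (f g : R -> W) : bcont f -> bcont g -> bcont (fun y => f y - g y).
Proof.
move=> [cf [M fM]] [cg [N gN]]; split; first by move=> x; apply: cvgB; [exact: cf|exact: cg].
by exists (M + N) => x; rewrite (le_trans (ler_normB _ _))// lerD.
Qed.

Lemma bcont_scale (W : normedModType R) (a : R) (f : R -> W) :
  bcont f -> bcont (fun x => a *: f x).
Proof.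
move=> [cf [M fM]]; split.
  by move=> x; apply: cvgZr; exact: cf.
by exists (`|a| * M) => x; rewrite normrZ ler_wpM2l.
Qed.

Lemma bcont_shift (W : normedModType R) (a : R) (f : R -> W) :
  bcont f -> bcont (fun x => f (x + a)).
Proof.
move=> [cf [M fM]]; split; last by exists M.
by move=> y; apply: continuous_comp; [apply: cvgD; [exact: cvg_id|exact: cvg_cst]|exact: cf].
Qed.

Lemma Rintegral_sum disp (T : measurableType disp) (mu : {measure set T -> \bar R})
    (I : Type) (r : seq I) (F : I -> T -> R) :
  (forall i, mu.-integrable [set: T] (EFin \o F i)) ->
  mu.-integrable [set: T] (EFin \o (fun x => \sum_(i <- r) F i x)) /\
  \int[mu]_x (\sum_(i <- r) F i x) = \sum_(i <- r) \int[mu]_x F i x.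
Proof.
move=> iF.
have int_r s : mu.-integrable [set: T] (EFin \o (fun x => \sum_(i <- s) F i x)).
  rewrite (_ : _ \o _ = (fun x => \sum_(i <- s) (F i x)%:E)%E).
    by apply: integrable_sum => // i _; exact: iF.
  by apply/funext => x /=; rewrite sumEFin.
split=> //; elim: r => [|i r IH].
  rewrite big_nil (_ : (fun x => _) = cst 0) ?Rintegral_cst// ?mul0r//.
  by apply/funext => x; rewrite big_nil.
by under eq_fun do rewrite big_cons; rewrite RintegralD// IH big_cons.
Qed.

Lemma continuous_mx_entry m n (f : R -> 'M[R]_(m, n)) i j :
  continuous f -> continuous (fun x => f x i j : R).
Proof.
move=> cf x.
exact: (continuous_comp (cf x) (differentiable_continuous (differentiable_coord _ i j))).
Qed.

Lemma continuous_mxP (T : topologicalType) m n (f : T -> 'M[R]_(m, n)) :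
  (forall i j, continuous (fun x => f x i j : R)) -> continuous f.
Proof.
move=> cf x; apply/(@cvgrPdist_le _ _ _ (nbhs x) _ f) => e e0; near=> y.
apply/mx_norm_leP; first exact: ltW.
move=> i j; rewrite !mxE; move: i j; near: y.
apply: filter_forall => i; apply: filter_forall => j.
have : (fun y => f y i j) @ x --> f x i j by exact: cf.
by move=> /cvgrPdist_le; exact.
Unshelve. all: end_near. Qed.

Lemma bcont_entry m n (f : R -> 'M[R]_(m, n)) i j :
  bcont f -> bcont (fun x => f x i j : R).
Proof.
move=> [cf [M fM]]; split; first exact: continuous_mx_entry.
by exists M => x; rewrite (le_trans (mx_entry_le _ _ _)).
Qed.

End BoundedContinuous.

Section ScalarConvolution.
Context {R : realType}.
Notation mu := (@lebesgue_measure R).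
Variable k : R -> R.
Hypothesis ik : mu.-integrable [set: R] (EFin \o k).

Definition sconv (f : R -> R) (x : R) : R := \int[mu]_y (k (x - y) * f y).

Let kn : R := \int[mu]_y `|k y|.

Let mk : measurable_fun [set: R] k.
Proof. by have /integrableP[/measurable_EFinP] := ik. Qed.

Let integrable_kM (h : R -> R) (M : R) : measurable_fun [set: R] h ->
  (forall z, `|h z| <= M) -> mu.-integrable [set: R] (fun z => (k z * h z)%:E).
Proof.
move=> mh hM; have iM : mu.-integrable [set: R] (fun z => (M%:E * (k z)%:E)%E).
  exact: integrableZl.
apply: le_integrable iM => //.
  by apply/measurable_EFinP; exact: measurable_funM.
move=> z _; rewrite lee_fin mulrC !normrM ler_wpM2r//.
exact: le_trans (hM z) (ler_norm M).
Qed.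

Lemma sconv_flip_integrable (f : R -> R) x : bcont f ->
  mu.-integrable [set: R] (fun z => (k z * f (x - z))%:E).
Proof.
move=> [cf [M fM]]; apply: (@integrable_kM (fun z => f (x - z)) M) => //.
apply: continuous_measurable_fun => z.
by apply: continuous_comp; [apply: cvgB; [exact: cvg_cst|exact: cvg_id]|exact: cf].
Qed.

Lemma sconv_integrable (f : R -> R) x : bcont f ->
  mu.-integrable [set: R] (fun y => (k (x - y) * f y)%:E).
Proof.
move=> bf.
have := @integrable_preserving _ _ _ mu _ (measurable_reflect x)
  (fun A mA => lebesgue_reflect x mA) _ (sconv_flip_integrable x bf).
by congr (_.-integrable _ _); apply/funext => y /=; rewrite subKr.
Qed.

(** This form puts the dependence on [x] into the regular factor, so that one may pass
to the limit and differentiate under the integral sign. *)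
Lemma sconvE (f : R -> R) x : bcont f -> sconv f x = \int[mu]_z (k z * f (x - z)).
Proof.
move=> bf.
rewrite -(@Rintegral_preserving _ _ _ mu _ (measurable_reflect x)
  (fun A mA => lebesgue_reflect x mA) _ (sconv_flip_integrable x bf)).
by congr Rintegral; apply/funext => y /=; rewrite subKr.
Qed.

Lemma sconv_shift (f : R -> R) a x : bcont f ->
  sconv (fun y => f (y + a)) x = sconv f (x + a).
Proof.
move=> bf.
rewrite /sconv -[RHS](@Rintegral_preserving _ _ _ mu _ (measurable_shift a)
  (fun A mA => lebesgue_shift a mA) _ (sconv_integrable (x + a) bf)).
congr Rintegral; apply/funext => y; congr (k _ * _).
by rewrite opprD addrACA subrr addr0.
Qed.

Lemma sconv_le (f : R -> R) (M : R) x : bcont f -> (forall y, `|f y| <= M) ->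
  `|sconv f x| <= M * kn.
Proof.
move=> bf fM; rewrite sconvE//.
have i1 := sconv_flip_integrable x bf.
rewrite (le_trans (le_normr_Rintegral _ i1))//.
have ink : mu.-integrable [set: R] (fun z => (`|k z|)%:E) by exact: (integrable_abse ik).
rewrite /kn -RintegralZl//; apply: le_Rintegral => //.
- exact: (integrable_abse i1).
- rewrite (_ : _ \o _ = fun z => (M%:E * (`|k z|)%:E)%E)//; exact: integrableZl.
by move=> z _; rewrite normrM mulrC ler_wpM2r.
Qed.

Lemma sconv_continuous (f : R -> R) : bcont f -> continuous (sconv f).
Proof.
move=> bf; have [cf [M fM]] := bf.
rewrite (_ : sconv f = fun x => \int[mu]_z (k z * f (x - z))); last first.
  by apply/funext => x; rewrite sconvE.
move=> x.
apply: (@continuity_under_integral _ _ _ mu (fun x z => k z * f (x - z)) setT _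
   (x - 1) (x + 1) _ _ (fun z => `|k z| * M)) => //.
- by move=> y _; exact: sconv_flip_integrable.
- apply: aeW => z _ y _.
  apply: cvgM; first exact: cvg_cst.
  by apply: continuous_comp; [apply: cvgB; [exact: cvg_id|exact: cvg_cst]|exact: cf].
- rewrite (_ : _ \o _ = fun z => ((`|k z|)%:E * M%:E)%E)//.
  by apply: integrableZr => //; exact: (integrable_abse ik).
- by move=> y _; apply: aeW => z _; rewrite normrM ler_wpM2l.
- by rewrite inE/= in_itv/= ltrBlDr ltrDl ltr01.
Qed.

Lemma sconv_bcont (f : R -> R) : bcont f -> bcont (sconv f).
Proof.
move=> bf; split; first exact: sconv_continuous.
by have [_ [M fM]] := bf; exists (M * kn) => x; exact: sconv_le.
Qed.

Lemma sconv_is_derive (f : R -> R) (x : R) : bcont f ->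
  (forall y, derivable f y 1) -> bcont ('D_1 f) ->
  is_derive x 1 (sconv f) (sconv ('D_1 f) x).
Proof.
move=> bf df bdf; have [cdf [M fM]] := bdf.
have M0 : 0 <= M by exact: le_trans (normr_ge0 _) (fM 0).
rewrite (_ : sconv f = fun x => \int[mu]_z (k z * f (x - z))); last first.
  by apply/funext => y; rewrite sconvE.
have Hd (y z : R) : is_derive y 1 (fun y => k z * f (y - z)) (k z * 'D_1 f (y - z)).
  have sh : is_derive y 1 (shift (- z)) (1 : R) by exact: is_derive_shift.
  have df' : is_derive (shift (- z) y) 1 f ('D_1 f (y - z)) by exact/derivableP/df.
  have := is_deriveZ (k z) (is_derive1_comp df' sh); rewrite mulr1.
  by apply.
have d1E (y z : R) : partial1of2 (fun x z => k z * f (x - z)) y z = k z * 'D_1 f (y - z).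
  by rewrite partial1of2E; have [] := Hd y z.
have Ix : `]x - 1, x + 1[%classic x by rewrite /= in_itv/= ltrBlDr ltrDl ltr01.
have intf y : `]x - 1, x + 1[%classic y ->
    mu.-integrable [set: R] (EFin \o (fun z => k z * f (y - z))).
  by move=> _; exact: sconv_flip_integrable.
have G0 (z : R) : 0 <= `|k z| * M by rewrite mulr_ge0.
have iG : mu.-integrable [set: R] (EFin \o (fun z => `|k z| * M)).
  rewrite (_ : _ \o _ = fun z => ((`|k z|)%:E * M%:E)%E)//.
  by apply: integrableZr => //; exact: (integrable_abse ik).
have Gub (y z : R) : `]x - 1, x + 1[%classic y -> [set: R] z ->
    `|partial1of2 (fun x z => k z * f (x - z)) y z| <= `|k z| * M.
  by move=> _ _; rewrite d1E normrM ler_wpM2l.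
have derf (y z : R) : `]x - 1, x + 1[%classic y -> [set: R] z ->
    derivable (fun y => k z * f (y - z)) y 1.
  by move=> _ _; have [] := Hd y z.
split.
  exact: (derivable_under_integral measurableT Ix intf derf G0 iG Gub).
rewrite -derive1E (differentiation_under_integral measurableT Ix intf derf G0 iG Gub).
rewrite sconvE//; congr Rintegral; apply/funext => z; exact: d1E.
Qed.

Lemma sconvB (f g : R -> R) x : bcont f -> bcont g ->
  sconv (fun y => f y - g y) x = sconv f x - sconv g x.
Proof.
move=> bf bg; rewrite /sconv -RintegralB//; [|exact: sconv_integrable..].
by congr Rintegral; apply/funext => y; rewrite mulrBr.
Qed.

Lemma sconvZ (a : R) (f : R -> R) x : bcont f ->
  sconv (fun y => a * f y) x = a * sconv f x.
Proof.
move=> bf; rewrite /sconv -RintegralZl//; last exact: sconv_integrable.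
by congr Rintegral; apply/funext => y; rewrite mulrCA.
Qed.

(** The remainder of the convolution is the convolution of the remainder, which costs at
most the mass of the kernel.  Uniformity over the whole line is essential here. *)
Lemma sconv_expand (dl : R -> R -> R) (p q : R -> R) :
  (forall t, bcont (dl t)) -> bcont p -> bcont q ->
  unif_expand [set: R] dl p q ->
  unif_expand [set: R] (fun t => sconv (dl t)) (sconv p) (sconv q).
Proof.
move=> bd bp bq U eps eps0.
have kn0 : 0 <= kn by apply: Rintegral_ge0.
have kn1 : 0 < kn + 1 by rewrite ltr_wpDl.
have [e e0 eP] := U _ (divr_gt0 eps0 kn1).
exists e => // t x _ te.
rewrite -sconvB// -[t *: _]sconvZ// -sconvB//; last 2 first.
- exact: bcontB.
- exact: (bcont_scale t bq).
have bd' := bcontB (bcontB (bd t) bp) (bcont_scale t bq).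
apply: le_trans (sconv_le x bd' (fun y => eP t y I te)) _.
rewrite mulrAC ler_wpM2r// -mulrA ler_piMr//; first exact: ltW.
by rewrite mulrC ler_pdivrMr// mul1r lerDl.
Qed.

End ScalarConvolution.

(** * Convolution with a matrix kernel *)

Section MatrixConvolution.
Context {R : realType} {d : nat}.
Notation mu := (@lebesgue_measure R).
Variable K : R -> 'M[R]_d.
Hypothesis iK : forall i j, mu.-integrable [set: R] (fun r => (K r i j)%:E).

Let Kij i j (r : R) : R := K r i j.
Let fj (f : R -> 'cV[R]_d) (j : 'I_d) (x : R) : R := f x j 0.

Let mulE (f : R -> 'cV[R]_d) x y i :
  (K (x - y) *m f y) i 0 = \sum_j Kij i j (x - y) * fj f j y.
Proof. by rewrite mxE. Qed.

Lemma bcont_conv_defined (f : R -> 'cV[R]_d) (x : R) : bcont f -> conv_defined K f x.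
Proof.
move=> bf i.
have [] := Rintegral_sum (index_enum 'I_d)
  (fun j => sconv_integrable (iK i j) x (bcont_entry j 0 bf)).
by under eq_fun do rewrite -mulE.
Qed.

Lemma conv_entry (f : R -> 'cV[R]_d) (x : R) i : bcont f ->
  conv K f x i 0 = \sum_j sconv (Kij i j) (fj f j) x.
Proof.
move=> bf; rewrite mxE.
have [_] := Rintegral_sum (index_enum 'I_d)
  (fun j => sconv_integrable (iK i j) x (bcont_entry j 0 bf)).
by under eq_fun do rewrite -mulE.
Qed.

Lemma conv_bcont (f : R -> 'cV[R]_d) : bcont f -> bcont (conv K f).
Proof.
move=> bf; split.
  apply: continuous_mxP => i j; rewrite (ord1 j).
  under eq_fun do rewrite (conv_entry _ _ bf).
  apply: continuous_bigsum => l.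
  exact: (sconv_continuous (iK i l) (bcont_entry l 0 bf)).
have /choice[M MP] : forall ij : 'I_d * 'I_d, exists M : R, forall x,
    `|sconv (Kij ij.1 ij.2) (fj f ij.2) x| <= M.
  by move=> [i j]; have [_ ] := sconv_bcont (iK i j) (bcont_entry j 0 bf).
exists (\sum_i \sum_l `|M (i, l)|) => x; apply/mx_norm_leP.
  by apply: sumr_ge0 => i _; exact: sumr_ge0.
move=> i j; rewrite (ord1 j) conv_entry// (le_trans (ler_norm_sum _ _ _))//.
apply: (@le_trans _ _ (\sum_l `|M (i, l)|)).
  by apply: ler_sum => l _; exact: le_trans (MP (i, l) x) (ler_norm _).
rewrite [leRHS](bigD1 i)//= lerDl.
by apply: sumr_ge0 => a _; exact: sumr_ge0.
Qed.

Lemma conv_is_derive (f : R -> 'cV[R]_d) (x : R) : bcont f ->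
  (forall y, derivable f y 1) -> bcont ('D_1 f) ->
  is_derive x 1 (conv K f) (conv K ('D_1 f) x).
Proof.
move=> bf df bdf.
have dfj j y : derivable (fj f j) y 1 by exact: (iffLR (derivable_mxP _ _ _) (df y) j 0).
have DE j : 'D_1 (fj f j) = fj ('D_1 f) j.
  by apply/funext => y; rewrite [RHS]/fj (derive_mx (df y)) mxE.
have He i : is_derive x 1 (fun x => conv K f x i 0) (conv K ('D_1 f) x i 0).
  under eq_fun do rewrite (conv_entry _ _ bf).
  rewrite conv_entry// (_ : (fun x => _) = \sum_j sconv (Kij i j) (fj f j)); last first.
    by apply/funext => y; rewrite fct_sumE.
  apply: is_derive_sum => j; rewrite -DE; apply: (sconv_is_derive (iK i j)) => //.
    exact: (bcont_entry j 0 bf).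
  by rewrite DE; exact: (bcont_entry j 0 bdf).
have dK : derivable (conv K f) x 1.
  by apply/derivable_mxP => i j; rewrite (ord1 j); have [] := He i.
split=> //; rewrite derive_mx//; apply/matrixP => i j; rewrite mxE (ord1 j).
by have [_] := He i.
Qed.

Lemma conv_shift (f : R -> 'cV[R]_d) (a x : R) : bcont f ->
  conv K (fun y => f (y + a)) x = conv K f (x + a).
Proof.
move=> bf.
have bfa := bcont_shift a bf.
apply/matrixP => i j; rewrite (ord1 j) !conv_entry//.
apply: eq_bigr => l _; by rewrite -(sconv_shift (iK i l) _ _ (bcont_entry l 0 bf)).
Qed.

Lemma conv_expand (dl : R -> R -> 'cV[R]_d) (p q : R -> 'cV[R]_d) :
  (forall t, bcont (dl t)) -> bcont p -> bcont q ->
  unif_expand [set: R] dl p q ->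
  unif_expand [set: R] (fun t => conv K (dl t)) (conv K p) (conv K q).
Proof.
move=> bd bp bq U; apply: unif_expand_mx => i j; rewrite (ord1 j).
have := @unif_expand_sum R R [set: R] 'I_d (index_enum _)
  (fun l t => sconv (Kij i l) (fj (dl t) l)) (fun l => sconv (Kij i l) (fj p l))
  (fun l => sconv (Kij i l) (fj q l)).
move=> /(_ _) H; have {}H : unif_expand [set: R] _ _ _ := H _.
suff : unif_expand [set: R] (fun t x => \sum_l sconv (Kij i l) (fj (dl t) l) x)
    (fun x => \sum_l sconv (Kij i l) (fj p l) x) (fun x => \sum_l sconv (Kij i l) (fj q l) x).
  by congr unif_expand; [apply/funext => t| |]; apply/funext => x; rewrite conv_entry.
apply: H => l; apply: (sconv_expand (iK i l)) => //.
- by move=> t; exact: (bcont_entry l 0 (bd t)).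
- exact: (bcont_entry l 0 bp).
- exact: (bcont_entry l 0 bq).
move=> eps eps0; have [e e0 eP] := U _ eps0; exists e => // t z _ te.
apply: le_trans (eP t z I te); have := mx_entry_le (dl t z - p z - t *: q z) l 0.
by rewrite !mxE.
Qed.

End MatrixConvolution.

(** * Scalar products, gradients and directional derivatives *)

Section Gradients.
Context {R : realType} {d : nat}.
Notation vec := 'cV[R]_d.
Notation phase := (R * vec * vec * vec)%type.

Lemma dotvE (a b : vec) : dotv a b = (a^T *m b) 0 0.
Proof. by rewrite /dotv mxE; apply: eq_bigr => i _; rewrite mxE. Qed.

Lemma dotvDr (a b c : vec) : dotv a (b + c) = dotv a b + dotv a c.
Proof. by rewrite !dotvE mulmxDr mxE. Qed.

Lemma dotvZr (a : vec) (t : R) (b : vec) : dotv a (t *: b) = t * dotv a b.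
Proof. by rewrite !dotvE -scalemxAr mxE. Qed.

Lemma dotvDl (a b c : vec) : dotv (b + c) a = dotv b a + dotv c a.
Proof. by rewrite !dotvE linearD/= mulmxDl mxE. Qed.

Lemma dotvNl (a b : vec) : dotv (- b) a = - dotv b a.
Proof. by rewrite !dotvE linearN/= mulNmx mxE. Qed.

Lemma dotv_trmul (A : 'M[R]_d) (a b : vec) : dotv (A^T *m a) b = dotv a (A *m b).
Proof. by rewrite !dotvE trmx_mul trmxK mulmxA. Qed.

Lemma dotvC (a b : vec) : dotv a b = dotv b a.
Proof. by rewrite /dotv; apply: eq_bigr => i _; rewrite mulrC. Qed.

Lemma dotv_le (a b : vec) : `|dotv a b| <= d%:R * (`|a| * `|b|).
Proof.
rewrite /dotv (le_trans (ler_norm_sum _ _ _))//.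
apply: (@le_trans _ _ (\sum_(i < d) `|a| * `|b|)).
  by apply: ler_sum => i _; rewrite normrM ler_pM// mx_entry_le.
by rewrite sumr_const card_ord -[leLHS]mulr_natl.
Qed.

Lemma vec_sum_delta (v : vec) : v = \sum_i v i 0 *: delta_mx i 0.
Proof. by rewrite [LHS]matrix_sum_delta; apply: eq_bigr => i _; rewrite big_ord1. Qed.

Lemma C1_derive_sum (V : normedModType R) (f : V -> R) (p : V) (I : Type) (r : seq I)
    (c : I -> R) (e : I -> V) : findim V -> Ck 1 f ->
  'D_(\sum_(i <- r) c i *: e i) f p = \sum_(i <- r) c i * 'D_(e i) f p.
Proof.
move=> fV f1; elim: r => [|i r IH]; first by rewrite !big_nil derive0.
by rewrite !big_cons C1_derive_linear// IH.
Qed.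

Lemma C1_derive_sum4 (V : normedModType R) (f : V -> R) (p v : V) (t : R)
    (e1 e2 e3 e4 : V) : findim V -> Ck 1 f ->
  v = t *: e1 + (e2 + (e3 + e4)) ->
  'D_v f p = t * 'D_e1 f p + 'D_e2 f p + 'D_e3 f p + 'D_e4 f p.
Proof.
move=> fV f1 ->; have DL := C1_derive_linear fV f1 p.
rewrite DL -{1}(scale1r e2) DL -{1}(scale1r e3) DL !mul1r; ring.
Qed.

Lemma Dmat_mulE (S : vec -> vec) (u v : vec) : Ck 1 S ->
  Dmat S u *m v = \col_i 'D_v (fun x => S x i 0) u.
Proof.
move=> S1; apply/matrixP => i j; rewrite (ord1 j) !mxE.
rewrite [in RHS](vec_sum_delta v) C1_derive_sum; last 2 first.
- exact: findim_cV.
- exact: Ck_entry.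
apply: eq_bigr => l _; rewrite mxE mulrC; congr (_ * _).
by have [_ [dS _]] := S1; rewrite derive_mx// mxE.
Qed.

Lemma Ck_derive (V W : normedModType R) k (f : V -> W) v :
  Ck k.+1 f -> Ck k ('D_v f).
Proof. by case=> _ [_]; apply. Qed.

Lemma findim_phase : findim phase.
Proof.
by do 3 (apply: findim_prod; last exact: findim_cV); exact: findimR.
Qed.

Variable L : R -> vec -> vec -> vec -> R.
Definition uncurried (p : phase) : R := L p.1.1.1 p.1.1.2 p.1.2 p.2.
Notation Lp := uncurried.
Hypothesis hL : lagrangian_C2 L.

Lemma uncurried_C2 : Ck 2 Lp.
Proof. exact: hL. Qed.

Lemma uncurried_C1 : Ck 1 Lp.
Proof. exact: (Ck_le (leqnSn 1) uncurried_C2). Qed.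

(** Two functions that agree along two lines, with the same parameter, have the same
directional derivatives; used to see the partial gradients of a Lagrangian as
directional derivatives on the product space. *)
Lemma derive_slice (V W : normedModType R) (f : V -> W) (p v : V) (U : normedModType R)
    (g : U -> W) (q w : U) :
  (forall h : R, f (h *: v + p) = g (h *: w + q)) -> 'D_v f p = 'D_w g q.
Proof.
move=> E; have E0 : f p = g q by have := E 0; rewrite !scale0r !add0r.
have H : (fun h : R => h^-1 *: ((f \o shift p) (h *: v) - f p)) =
    (fun h : R => h^-1 *: ((g \o shift q) (h *: w) - g q)).
  by apply/funext => h /=; rewrite E E0.
by rewrite /derive H.
Qed.

Lemma linear_sum_delta (V : normedModType R) (J : vec -> V) (v : vec) :
  (forall a u v, J (a *: u + v) = a *: J u + J v) ->
  J v = \sum_i v i 0 *: J (delta_mx i 0).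
Proof.
move=> Jl.
have J0 : J 0 = 0.
  by have := Jl (-1) 0 0; rewrite scaler0 addr0 scaleN1r addNr.
rewrite [in LHS](vec_sum_delta v).
elim: (index_enum _) => [|i r IH]; first by rewrite !big_nil.
by rewrite !big_cons Jl IH.
Qed.

(** [J] is the inclusion of one of the three vector factors into the space of jets. *)
Lemma dotv_grad_slice (J : vec -> phase) (g : vec -> R) (p : phase) (a v : vec) :
  (forall a u v, J (a *: u + v) = a *: J u + J v) ->
  (forall h w, Lp (h *: J w + p) = g (h *: w + a)) ->
  dotv (grad g a) v = 'D_(J v) Lp p.
Proof.
move=> Jl Jg; rewrite (linear_sum_delta v Jl).
rewrite C1_derive_sum; [|exact: findim_phase|exact: uncurried_C1].
apply: eq_bigr => i _; rewrite mxE mulrC; congr (_ * _).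
by apply: esym; apply: derive_slice => h; exact: Jg.
Qed.

Let pairZD (h : R) (p q : phase) : h *: p + q =
  (h * p.1.1.1 + q.1.1.1, h *: p.1.1.2 + q.1.1.2, h *: p.1.2 + q.1.2, h *: p.2 + q.2).
Proof. by case: p q => [[[? ?] ?] ?] [[[? ?] ?] ?]. Qed.

Lemma dotv_grad_u x a b c v :
  dotv (grad_u L x a b c) v = 'D_((0, v, 0, 0) : phase) Lp (x, a, b, c).
Proof.
apply: (@dotv_grad_slice (fun v => (0, v, 0, 0))) => [h u w|h w]; rewrite pairZD/=.
  by rewrite mulr0 !scaler0 !addr0.
by rewrite /Lp/= mulr0 !scaler0 !add0r.
Qed.

Lemma dotv_grad_v x a b c v :
  dotv (grad_v L x a b c) v = 'D_((0, 0, v, 0) : phase) Lp (x, a, b, c).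
Proof.
apply: (@dotv_grad_slice (fun v => (0, 0, v, 0))) => [h u w|h w]; rewrite pairZD/=.
  by rewrite mulr0 !scaler0 !addr0.
by rewrite /Lp/= mulr0 !scaler0 !add0r.
Qed.

Lemma dotv_grad_n x a b c v :
  dotv (grad_n L x a b c) v = 'D_((0, 0, 0, v) : phase) Lp (x, a, b, c).
Proof.
apply: (@dotv_grad_slice (fun v => (0, 0, 0, v))) => [h u w|h w]; rewrite pairZD/=.
  by rewrite mulr0 !scaler0 !addr0.
by rewrite /Lp/= mulr0 !scaler0 !add0r.
Qed.

Lemma derive_phaseE (x : R) (a b c : vec) (t : R) (ut vt nt : vec) :
  'D_((t, ut, vt, nt) : phase) Lp (x, a, b, c) =
  t * 'D_((1, 0, 0, 0) : phase) Lp (x, a, b, c) + dotv (grad_u L x a b c) ut +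
  dotv (grad_v L x a b c) vt + dotv (grad_n L x a b c) nt.
Proof.
rewrite dotv_grad_u dotv_grad_v dotv_grad_n.
apply: (@C1_derive_sum4 phase Lp (x, a, b, c) (t, ut, vt, nt) t (1, 0, 0, 0)
  (0, ut, 0, 0) (0, 0, vt, 0) (0, 0, 0, nt) findim_phase uncurried_C1).
rewrite -[RHS]/(t * 1 + (0 + (0 + 0)), t *: 0 + (ut + (0 + 0)),
   t *: 0 + (0 + (vt + 0)), t *: 0 + (0 + (0 + nt))).
by rewrite !mulr1 !scaler0 !addr0 !add0r.
Qed.

Lemma grad_v_entry x a b c i :
  grad_v L x a b c i 0 = 'D_((0, 0, delta_mx i 0, 0) : phase) Lp (x, a, b, c).
Proof.
rewrite -dotv_grad_v /dotv (bigD1 i)//= [delta_mx _ _ _ _]mxE !eqxx mulr1 big1 ?addr0// => j ji.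
by rewrite [delta_mx _ _ _ _]mxE (negbTE ji) mulr0.
Qed.

Lemma grad_n_entry x a b c i :
  grad_n L x a b c i 0 = 'D_((0, 0, 0, delta_mx i 0) : phase) Lp (x, a, b, c).
Proof.
rewrite -dotv_grad_n /dotv (bigD1 i)//= [delta_mx _ _ _ _]mxE !eqxx mulr1 big1 ?addr0// => j ji.
by rewrite [delta_mx _ _ _ _]mxE (negbTE ji) mulr0.
Qed.

End Gradients.

(** * Calculus along curves *)

Section Composition.
Context {R : realType}.

Lemma findim_continuous_bounded (V W : normedModType R) (f : V -> W) (M : R) :
  findim V -> continuous f -> exists B : R, forall v, `|v| <= M -> `|f v| <= B.
Proof.
move=> [_ cK] cf; have [C cC CM] := cK M.
have [B _ BP] := compact_continuous_bounded cC cf.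
by exists B => v /CM; exact: BP.
Qed.

Lemma bcont_comp (V W : normedModType R) (f : V -> W) (g : R -> V) :
  findim V -> continuous f -> bcont g -> bcont (f \o g).
Proof.
move=> fV cf [cg [M gM]]; split.
  by move=> x; exact: (continuous_comp (cg x) (cf (g x))).
by have [B BP] := findim_continuous_bounded M fV cf; exists B => x; exact: BP.
Qed.

Lemma continuous_mulmx (T : topologicalType) m n k (f : T -> 'M[R]_(m, n)) (g : T -> 'M[R]_(n, k)) :
  continuous f -> continuous g -> continuous (fun x => f x *m g x).
Proof.
move=> cf cg; apply: continuous_mxP => i j.
under eq_fun do rewrite mxE.
apply: continuous_bigsum => l x; apply: cvgM.
  exact: (continuous_comp (cf x) (differentiable_continuous (differentiable_coord _ i l))).
exact: (continuous_comp (cg x) (differentiable_continuous (differentiable_coord _ l j))).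
Qed.

Lemma bcont_mulmx m n k (f : R -> 'M[R]_(m, n)) (g : R -> 'M[R]_(n, k)) :
  bcont f -> bcont g -> bcont (fun x => f x *m g x).
Proof.
move=> [cf [M fM]] [cg [N gN]]; split; first exact: continuous_mulmx.
exists (n%:R * M * N) => x; rewrite (le_trans (norm_mulmx_le _ _))//.
by rewrite ler_pM ?mulr_ge0// ler_wpM2l.
Qed.

Lemma continuous_pair (T : topologicalType) (V W : topologicalType) (f : T -> V) (g : T -> W) :
  continuous f -> continuous g -> continuous (fun x => (f x, g x)).
Proof. by move=> cf cg x; apply: cvg_pair; [exact: cf|exact: cg]. Qed.

Lemma is_derive_pair (V W : normedModType R) (f : R -> V) (g : R -> W) (x : R) df dg :
  is_derive x 1 f df -> is_derive x 1 g dg ->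
  is_derive x 1 (fun y => (f y, g y)) (df, dg).
Proof.
move=> [f1 f2] [g1 g2].
have /derivable1_diffP f1' := f1; have /derivable1_diffP g1' := g1.
have H := differentiable_pair f1' g1'.
split; first exact/derivable1_diffP.
by rewrite deriveE// diff_pair// -!deriveE// f2 g2.
Qed.

Lemma is_derive_mulmxl m n k (A : 'M[R]_(m, n)) (f : R -> 'M[R]_(n, k)) (x : R) df :
  is_derive x 1 f df -> is_derive x 1 (fun y => A *m f y) (A *m df).
Proof.
move=> [f1 f2].
have cA : continuous (mulmx A : 'M[R]_(n, k) -> 'M[R]_(m, k)).
  by apply: (@continuous_mulmx _ _ _ _ (fun=> A) id); [exact: cst_continuous|move=> y; exact: cvg_id].
have /derivable1_diffP f1' := f1.
have dA y : differentiable (mulmx A : 'M[R]_(n, k) -> 'M[R]_(m, k)) y.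
  exact: (@linear_differentiable _ _ _ (mulmx A : {linear 'M[R]_(n, k) -> 'M[R]_(m, k)}) y cA).
split; first by apply/derivable1_diffP; exact: (differentiable_comp f1' (dA _)).
rewrite deriveE; last exact: (differentiable_comp f1' (dA _)).
rewrite (diff_comp f1' (dA _))/= diff_lin//; congr (_ *m _).
by rewrite -deriveE// f2.
Qed.

Lemma continuous_integrable (f : R -> R) (a b : R) : continuous f ->
  (@lebesgue_measure R).-integrable `[a, b] (EFin \o f).
Proof.
move=> cf; apply: continuous_compact_integrable; first exact: segment_compact.
exact: continuous_subspaceT.
Qed.

Lemma unif_expand_integral (a b : R) (h : R -> R -> R) (p q : R -> R) : a < b ->
  (forall t, continuous (h t)) -> continuous p -> continuous q ->
  unif_expand `[a, b] h p q ->
  unif_expand [set: unit] (fun t _ => \int[lebesgue_measure]_(z in `[a, b]) h t z)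
    (fun=> \int[lebesgue_measure]_(z in `[a, b]) p z)
    (fun=> \int[lebesgue_measure]_(z in `[a, b]) q z).
Proof.
move=> ab ch cp cq U eps eps0.
have ab0 : 0 < b - a by rewrite subr_gt0.
have [e e0 eP] := U _ (divr_gt0 eps0 ab0); exists e => // t _ _ te.
have ih := continuous_integrable a b (ch t).
have ip := continuous_integrable a b cp; have iq := continuous_integrable a b cq.
have itq : (@lebesgue_measure R).-integrable `[a, b] (EFin \o (fun z => t * q z)).
  by apply: continuous_integrable => z; apply: cvgM; [exact: cvg_cst|exact: cq].
have ihp : (@lebesgue_measure R).-integrable `[a, b] (EFin \o (fun z => h t z - p z)).
  by apply: continuous_integrable => z; apply: cvgB; [exact: ch|exact: cp].
have ihpq : (@lebesgue_measure R).-integrable `[a, b] (EFin \o (fun z => h t z - p z - t * q z)).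
  apply: continuous_integrable => z; apply: cvgB; first by apply: cvgB; [exact: ch|exact: cp].
  by apply: cvgM; [exact: cvg_cst|exact: cq].
rewrite -RintegralB// -[t *: _]RintegralZl// -RintegralB//.
rewrite (le_trans (le_normr_Rintegral _ ihpq))//.
apply: (@le_trans _ _ (\int[lebesgue_measure]_(z in `[a, b]) (eps / (b - a) * `|t|))).
  apply: le_Rintegral => //.
  - exact: (integrable_abse ihpq).
  - by apply: (continuous_integrable a b) => z; exact: cvg_cst.
  by move=> z zab; apply: eP.
rewrite Rintegral_cst//= lebesgue_measure_itv/= lte_fin ab -EFinB/=.
by rewrite mulrAC divfK// gt_eqF.
Qed.

(** Both [q x] and 0 are the derivative at [x] of the primitive of [q] that starts at
[x - 1]. *)
Lemma Rintegral_zero_continuous (q : R -> R) : continuous q ->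
  (forall a b, a < b -> \int[lebesgue_measure]_(z in `[a, b]) q z = 0) ->
  forall x, q x = 0.
Proof.
move=> cq H x.
have xx : x < x + 1 by rewrite ltrDl.
have xx' : x - 1 < x by rewrite ltrBlDr ltrDl.
have [_ <-] := continuous_FTC1_closed xx (continuous_integrable (x - 1) (x + 1) cq) xx' (cq x).
rewrite derive1E (@near_eq_derive _ _ _ _ (cst 0) x 1).
- by rewrite derive_cst.
near=> y; rewrite /= H//.
near: y; exact: lt_nbhsr.
Unshelve. all: end_near. Qed.

End Composition.

(** * Differentiating the action along a symmetry *)

Section Symmetry.
Context {R : realType} {d : nat}.
Notation vec := 'cV[R]_d.
Notation mat := 'M[R]_d.
Notation phase := (R * vec * vec * vec)%type.
Variables (K : R -> mat) (S : vec -> vec) (L : R -> vec -> vec -> vec -> R).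
Variables (xi : mat * R) (u : R -> vec).
Hypothesis iK : forall i j,
  (@lebesgue_measure R).-integrable [set: R] (fun r => (K r i j)%:E).
Hypothesis hS : Ck 1 S.
Hypothesis hL : lagrangian_C2 L.
Hypothesis bu : bcont u.
Hypothesis du : forall x, derivable u x 1.
Hypothesis bu' : bcont ('D_1 u).
Notation Lp := (uncurried L).

Let cS : continuous S. Proof. by case: hS. Qed.

Lemma continuous_Dmat : continuous (Dmat S).
Proof.
apply: continuous_mxP => i j.
rewrite (_ : (fun _ => _) = 'D_(delta_mx j 0) (fun x => S x i 0)).
  by have [_ [_ cD]] := Ck_entry i 0 hS; have [] := cD (delta_mx j 0).
apply/funext => x; rewrite mxE; have [_ [dS _]] := hS.
by rewrite derive_mx// mxE.
Qed.

Lemma bcont_Dmat_mul (w : R -> vec) : bcont w -> bcont (fun y => Dmat S (u y) *m w y).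
Proof.
move=> bw; apply: bcont_mulmx => //.
exact: (bcont_comp (findim_cV d) continuous_Dmat bu).
Qed.

Lemma bcont_S_comp (w : R -> vec) : bcont w -> bcont (S \o w).
Proof. exact: bcont_comp (findim_cV d) cS. Qed.

Lemma bcont_mulmxl (A : mat) (w : R -> vec) : bcont w -> bcont (fun y => A *m w y).
Proof. by move=> bw; apply: bcont_mulmx => //; exact: bcont_cst. Qed.

Lemma is_derive_comp_shift (w : R -> vec) (c x : R) (dw : vec) :
  is_derive (x + c) 1 w dw -> is_derive x 1 (fun y => w (y + c)) dw.
Proof.
move=> [w1 w2].
have H : (fun h : R => h^-1 *: (((fun y => w (y + c)) \o shift x) (h *: 1) - w (x + c))) =
  (fun h : R => h^-1 *: ((w \o shift (x + c)) (h *: 1) - w (x + c))).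
  by apply/funext => h /=; rewrite addrA.
by split; [rewrite /derivable H|rewrite /derive H].
Qed.

(** [dl s z] is the point at which the transformed action evaluates the Lagrangian, after
translation back to the original interval; [p] is its value at [s = 0] and [q] its
velocity there. *)
Let E (s : R) : mat := expmx (s *: xi.1).
Let t : R := xi.2.
Let q (z : R) : phase := (- t, xi.1 *m u z, xi.1 *m 'D_1 u z,
  conv K (fun y => Dmat S (u y) *m (xi.1 *m u y)) z).
Let N (s : R) (z : R) : vec := conv K (fun y => S (E s *m u y)) z.
Let dl (s z : R) : phase := (z - s * t, E s *m u z, E s *m 'D_1 u z, N s z).
Let p (z : R) : phase := (z, u z, 'D_1 u z, conv K (S \o u) z).

Let bSE s : bcont (fun y => S (E s *m u y)).
Proof. exact: (bcont_S_comp (bcont_mulmxl (E s) bu)). Qed.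

(** The flow acts on the jet by left multiplication and translation; translation
commutes with the convolution. *)
Lemma along_act (s x : R) :
  along L K S (act_fun (gexp s xi) u) x = Lp (dl s (x + s * t)).
Proof.
rewrite /along /dl /uncurried /act_fun /phi /gexp /= addrK.
congr (L _ _ _ _).
  rewrite derive1E.
  have := @is_derive_comp_shift (fun y => E s *m u y) (s * xi.2) x (E s *m 'D_1 u (x + s * xi.2)).
  by move=> /(_ (is_derive_mulmxl (E s) (derivableP (@du _))))[_ ->].
by rewrite /N -(conv_shift iK _ _ (bSE s)).
Qed.

Let U_mul (w : R -> vec) (D : set R) : bcont w ->
  unif_expand D (fun s y => E s *m w y) w (fun y => xi.1 *m w y).
Proof.
move=> [_ [M uM]].
pose B := `|1%:M : mat| + `|xi.1| + `|M|.
have := @unif_expand_mulmx _ R D _ _ _ _ _ _ _ _ _ B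
  (unif_expand_expmx D xi.1) (unif_expand_cst D w).
have HB z : D z -> [/\ `|1%:M : mat| <= B, `|xi.1| <= B, `|w z| <= B & `|0 : vec| <= B].
  move=> _; have := uM z; have := ler_norm M; have := normr_ge0 M.
  have := normr_ge0 (1%:M : mat); have := normr_ge0 xi.1; rewrite normr0 /B.
  by split; lra.
move=> /(_ HB); congr unif_expand; apply/funext => y.
  by rewrite mul1mx.
by rewrite mulmx0 addr0.
Qed.

Let D_S_expand : unif_expand [set: R] (fun s y => S (E s *m u y)) (S \o u)
  (fun y => Dmat S (u y) *m (xi.1 *m u y)).
Proof.
apply: unif_expand_mx => i j; rewrite (ord1 j).
have [[_ [M uM]] [_ [M' u'M]]] := (bu, bcont_mulmxl xi.1 bu).
have U := @U_mul u [set: R] bu.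
have := unif_expand_C1 (findim_cV d) (Ck_entry i 0 hS) U (M := `|M| + `|M'|).
have h1 z : [set: R] z -> `|u z| <= `|M| + `|M'|.
  by move=> _; rewrite (le_trans (uM z))// (le_trans (ler_norm M))// lerDl.
have h2 z : [set: R] z -> `|xi.1 *m u z| <= `|M| + `|M'|.
  by move=> _; rewrite (le_trans (u'M z))// (le_trans (ler_norm M'))// lerDr.
move=> /(_ h1 h2); congr unif_expand; apply/funext => y.
by rewrite Dmat_mulE// mxE.
Qed.

Let N_expand : unif_expand [set: R] N (conv K (S \o u))
  (conv K (fun y => Dmat S (u y) *m (xi.1 *m u y))).
Proof.
apply: (@conv_expand _ _ K iK (fun s y => S (E s *m u y))) => //.
- exact: bcont_S_comp.
- exact/bcont_Dmat_mul/bcont_mulmxl.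
Qed.

Let dl_expand (a b : R) : unif_expand `[a, b] dl p q.
Proof.
apply: unif_expand_pair; last exact: (unif_expand_sub (D := [set: R])).
apply: unif_expand_pair; last exact: U_mul.
apply: unif_expand_pair; last exact: U_mul.
have := unif_expand_affine `[a, b] (id : R -> R) (fun=> - t).
by congr unif_expand; apply/funext => s; apply/funext => z; rewrite /GRing.scale/= mulrN.
Qed.

Let bconv : bcont (conv K (S \o u)).
Proof. exact: (conv_bcont iK (bcont_S_comp bu)). Qed.

Let bm : bcont (conv K (fun y => Dmat S (u y) *m (xi.1 *m u y))).
Proof. exact: (conv_bcont iK (bcont_Dmat_mul (bcont_mulmxl _ bu))). Qed.

Let cp : continuous p.
Proof.
have [[cu _] [cu' _] [cN _]] := And3 bu bu' bconv.
by do 3 (apply: continuous_pair => //); move=> x; exact: cvg_id.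
Qed.

Let cq : continuous q.
Proof.
have [[cu _] [cu' _] [cN _]] := And3 (bcont_mulmxl xi.1 bu) (bcont_mulmxl xi.1 bu') bm.
by do 3 (apply: continuous_pair => //); exact: cst_continuous.
Qed.

Let cdl s : continuous (dl s).
Proof.
have [[cu _] [cu' _] [cN _]] := And3 (bcont_mulmxl (E s) bu) (bcont_mulmxl (E s) bu')
  (conv_bcont iK (bSE s)).
do 3 (apply: continuous_pair => //); move=> x.
by apply: cvgB; [exact: cvg_id|exact: cvg_cst].
Qed.

Let cLp : continuous Lp. Proof. by case: (uncurried_C1 hL). Qed.

(** Translating the variable by [s * t] cancels the motion of the end points, so that
only the integrand depends on [s]. *)
Let action_act (s a b : R) : a < b ->
  action_fun L K S (act_fun (gexp s xi) u) (act_pt (gexp s xi) a) (act_pt (gexp s xi) b) =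
  \int[lebesgue_measure]_(z in `[a, b]) Lp (dl s z).
Proof.
move=> ab; rewrite /action_fun /oint /act_pt /=.
rewrite [X in _ - X](_ : _ = 0) ?subr0; last first.
  rewrite set_itv_ge ?Rintegral_set0//.
  by rewrite bnd_simp -ltNge ltrD2r.
under eq_Rintegral do rewrite along_act.
rewrite Rintegral_mkcond [RHS]Rintegral_mkcond.
have cLd : continuous (fun z => Lp (dl s z)).
  by move=> z; exact: (continuous_comp (@cdl s z) (@cLp (dl s z))).
have i1 := continuous_integrable a b cLd.
have i2 : (@lebesgue_measure R).-integrable [set: R]
    (EFin \o ((fun z => Lp (dl s z)) \_ `[a, b])).
  by rewrite -restrict_EFin; apply/(@integrable_mkcond _ _ _ (@lebesgue_measure R) _ _ (measurable_itv _)).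
rewrite -[RHS](@Rintegral_preserving _ _ _ (@lebesgue_measure R) _ (measurable_shift (s * t))
  (fun A mA => lebesgue_shift (s * t) mA) _ i2).
congr Rintegral; apply/funext => x; rewrite !patchE.
congr (if _ then _ else _).
by apply/idP/idP; rewrite !inE/= !in_itv/= lerBlDr lerBrDr.
Qed.

Hypothesis sym : forall a b : R, is_derive (0 : R) (1 : R)
  (fun s : R => action_fun L K S (act_fun (gexp s xi) u)
     (act_pt (gexp s xi) a) (act_pt (gexp s xi) b) : R) (0 : R).

(** The symmetry hypothesis says that the integral over every interval of this continuous
function is zero, once the action is differentiated under the integral sign. *)
Lemma symmetry_identity z : 'D_(q z) Lp (p z) = 0.
Proof.
have cD : continuous (fun z => 'D_(q z) Lp (p z)).
  exact: (C1_derive_continuous (@findim_phase R d) (uncurried_C1 hL) (@cp) (@cq)).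
apply: (Rintegral_zero_continuous (q := fun z => 'D_(q z) Lp (p z))) => // a b ab.
clear z.
have [M1 _ pM1] := compact_continuous_bounded (segment_compact (a := a) (b := b)) (@cp).
have [M2 _ qM2] := compact_continuous_bounded (segment_compact (a := a) (b := b)) (@cq).
have pM z : `[a, b]%classic z -> `|p z| <= `|M1| + `|M2|.
  by move=> /pM1/le_trans; apply; rewrite (le_trans (ler_norm M1))// lerDl.
have qM z : `[a, b]%classic z -> `|q z| <= `|M1| + `|M2|.
  by move=> /qM2/le_trans; apply; rewrite (le_trans (ler_norm M2))// lerDr.
have U := unif_expand_C1 (@findim_phase R d) (uncurried_C1 hL) (dl_expand a b) pM qM.
have U' := unif_expand_integral ab
  (fun s z => continuous_comp (@cdl s z) (@cLp (dl s z)))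
  (fun z => continuous_comp (@cp z) (@cLp (p z)))
  cD U.
have [_ <-] := unif_expand_is_derive (z := tt) U' I.
have [_ H] := sym a b; rewrite -[RHS]H; congr ('D_(1 : R) _ (0 : R)).
by apply/funext => s; rewrite action_act.
Qed.

End Symmetry.

(** * The jet of a curve and its derivative *)

Section DotProduct.
Context {R : realType} {d : nat}.
Notation vec := 'cV[R]_d.

Lemma is_derive_mx m n (f : R -> 'M[R]_(m, n)) (x : R) (df : 'M[R]_(m, n)) :
  (forall i j, is_derive x 1 (fun y => f y i j : R) (df i j)) -> is_derive x 1 f df.
Proof.
move=> H.
have D : derivable f x 1 by apply/derivable_mxP => i j; have [] := H i j.
by split=> //; rewrite derive_mx//; apply/matrixP => i j; rewrite mxE; have [_] := H i j.
Qed.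

Lemma is_derive_mx_entry m n (f : R -> 'M[R]_(m, n)) (x : R) (df : 'M[R]_(m, n)) i j :
  is_derive x 1 f df -> is_derive x 1 (fun y => f y i j : R) (df i j).
Proof.
move=> [f1 <-]; split; first exact: (iffLR (derivable_mxP _ _ _) f1 i j).
by rewrite (derive_mx f1) mxE.
Qed.

Lemma is_derive_dotv (a b : R -> vec) (x : R) (da db : vec) :
  is_derive x 1 a da -> is_derive x 1 b db ->
  is_derive x 1 (fun y => dotv (a y) (b y)) (dotv da (b x) + dotv (a x) db).
Proof.
move=> Da Db.
rewrite (_ : (fun y => _) = \sum_i ((fun y => a y i 0) * (fun y => b y i 0))); last first.
  by apply/funext => y; rewrite fct_sumE.
rewrite (_ : _ + _ = \sum_i (a x i 0 * db i 0 + b x i 0 * da i 0)); last first.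
  by rewrite big_split/= addrC; congr (_ + _); apply: eq_bigr => i _; rewrite mulrC.
apply: is_derive_sum => i.
exact: (is_deriveM (is_derive_mx_entry i 0 Da) (is_derive_mx_entry i 0 Db)).
Qed.

Lemma continuous_dotv (T : topologicalType) (a b : T -> vec) :
  continuous a -> continuous b -> continuous (fun y => dotv (a y) (b y)).
Proof.
move=> ca cb; apply: continuous_bigsum => i x; apply: cvgM.
  exact: (continuous_comp (ca x) (differentiable_continuous (differentiable_coord _ i 0))).
exact: (continuous_comp (cb x) (differentiable_continuous (differentiable_coord _ i 0))).
Qed.

Lemma dotv0l (a : vec) : dotv 0 a = 0.
Proof. by rewrite /dotv big1// => i _; rewrite mxE mul0r. Qed.

End DotProduct.

Section Jet.
Context {R : realType} {d : nat}.
Notation vec := 'cV[R]_d.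
Notation mat := 'M[R]_d.
Notation phase := (R * vec * vec * vec)%type.
Variables (K : R -> mat) (S : vec -> vec) (L : R -> vec -> vec -> vec -> R).
Variables (xi : mat * R) (u : R -> vec).
Hypothesis iK : forall i j,
  (@lebesgue_measure R).-integrable [set: R] (fun r => (K r i j)%:E).
Hypothesis hS : Ck 1 S.
Hypothesis hL : lagrangian_C2 L.
Hypothesis hu : Cb (reg L) u.
Notation Lp := (uncurried L).

Lemma reg_ge1 : (1 <= reg L)%N.
Proof. by rewrite /reg; case: ifP. Qed.

Lemma Cb_bcont : [/\ bcont u, forall x, derivable u x 1 & bcont ('D_1 u)].
Proof.
have [uC ub] := hu; have [cu [du cdu]] := Ck_le reg_ge1 uC.
split => //.
  by split => //; have [M uM] := ub 0 (leq0n _); exists M.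
split; first by have [] := cdu 1.
by have [M uM] := ub 1 reg_ge1; exists M => x; have := uM x; rewrite derive1n1 derive1E.
Qed.

Let bu : bcont u. Proof. by have [] := Cb_bcont. Qed.
Let du x : derivable u x 1. Proof. by have [_ + _] := Cb_bcont; exact. Qed.
Let bu' : bcont ('D_1 u). Proof. by have [] := Cb_bcont. Qed.

Definition curve (x : R) : phase := (x, u x, 'D_1 u x, conv K (S \o u) x).

Lemma alongE (T : Type) (F : R -> vec -> vec -> vec -> T) (x : R) :
  along F K S u x = F x (u x) ('D_1 u x) (conv K (S \o u) x).
Proof. by rewrite /along derive1E. Qed.

Lemma derive_S_comp : 'D_1 (S \o u) = (fun y => Dmat S (u y) *m 'D_1 u y) /\
  forall y, derivable (S \o u) y 1.
Proof.
have H (y : R) : is_derive y 1 (S \o u) (Dmat S (u y) *m 'D_1 u y).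
  apply: is_derive_mx => i j; rewrite (ord1 j) Dmat_mulE// mxE.
  exact: (C1_comp_curve (findim_cV d) (Ck_entry i 0 hS) (derivableP (@du y))).
by split; [apply/funext => y; have [] := H y|move=> y; have [] := H y].
Qed.

Let n' := conv K (fun y => Dmat S (u y) *m 'D_1 u y).

Lemma bcont_conv_S : bcont (conv K (S \o u)).
Proof. by apply: (conv_bcont iK); exact: bcont_S_comp. Qed.

Lemma is_derive_conv_S (x : R) : is_derive x 1 (conv K (S \o u)) (n' x).
Proof.
have [DE dS] := derive_S_comp.
have bDS : bcont ('D_1 (S \o u)) by rewrite DE; exact: (bcont_Dmat_mul hS bu bu').
rewrite /n' -DE.
exact: (conv_is_derive iK x (bcont_S_comp hS bu) dS bDS).
Qed.

Lemma continuous_n' : continuous n'.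
Proof. by have [] := conv_bcont iK (bcont_Dmat_mul hS bu bu'). Qed.

Lemma continuous_curve : continuous curve.
Proof.
have [[cu _] [cu' _] [cN _]] := And3 bu bu' bcont_conv_S.
by do 3 (apply: continuous_pair => //); move=> x; exact: cvg_id.
Qed.

(** Mean value theorem along the segment joining the two velocities. *)
Lemma L_indep_v : (forall x a b c, grad_v L x a b c = 0) ->
  forall x a b b' c, L x a b c = L x a b' c.
Proof.
move=> gv0 x a b b' c.
have D0 w (p : phase) : 'D_((0, 0, w, 0) : phase) Lp p = 0.
  by case: p => [[[y a'] e] f]; rewrite -dotv_grad_v// gv0 dotv0l.
have [_ [dL _]] := uncurried_C1 hL.
have [s _] := dir_mvt ((x, a, b', c) : phase) 1 (fun p => dL p (0, 0, b - b', 0)).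
rewrite D0 mulr0 => /eqP; rewrite subr_eq0 => /eqP H.
rewrite -[RHS]/(Lp (x, a, b', c)) -H.
rewrite -[RHS]/(L (x + 1 * 0) (a + 1 *: 0) (b' + 1 *: (b - b')) (c + 1 *: 0)).
by rewrite mulr0 !scaler0 !addr0 scale1r subrKC.
Qed.

(** [w] stands for the second derivative of [u].  If [grad_v L] vanishes identically, [u]
need not have one; then [L] does not depend on its velocity argument, only products
with [grad_v L] involve [w], and [w = 0] serves.  Otherwise [u] is of class C2 and [w]
is the true second derivative. *)
Lemma second_derivative_data : exists w gv' : R -> vec,
  [/\ continuous w, continuous gv',
    forall x : R, is_derive x 1 (along L K S u)
      ('D_((1, 'D_1 u x, w x, n' x) : phase) Lp (curve x)),
    forall x : R, is_derive x 1 (along (grad_v L) K S u) (gv' x) &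
    forall x : R, is_derive x 1 (fun y => dotv (along (grad_v L) K S u y) ('D_1 u y))
      (dotv (gv' x) ('D_1 u x) + dotv (along (grad_v L) K S u x) (w x))].
Proof.
have LE : along L K S u = Lp \o curve by apply/funext => x; rewrite alongE.
have [gv0|ngv0] := pselect (forall x a b c, grad_v L x a b c = 0).
  exists (fun=> 0), (fun=> 0).
  have gE : along (grad_v L) K S u = cst 0 by apply/funext => x; rewrite /along gv0.
  split; [exact: cst_continuous|exact: cst_continuous| | |].
  - move=> x.
    pose g y : phase := (y, u y, 'D_1 u x, conv K (S \o u) y).
    have -> : along L K S u = Lp \o g.
      by apply/funext => y; rewrite alongE; exact: (L_indep_v gv0).
    have Dg : is_derive x 1 g (1, 'D_1 u x, 0, n' x).
      exact: (is_derive_pair (is_derive_pair (is_derive_pair (is_derive_id x (1 : R))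
        (derivableP (@du x))) (is_derive_cst ('D_1 u x) x (1 : R))) (is_derive_conv_S x)).
    exact: (C1_comp_curve (@findim_phase R d) (uncurried_C1 hL) Dg).
  - by move=> x; rewrite gE; exact: is_derive_cst.
  - move=> x; rewrite gE (_ : (fun y => _) = cst 0); last first.
      by apply/funext => y; rewrite dotv0l.
    by rewrite !dotv0l addr0; exact: is_derive_cst.
have uC2 : Ck 2 u.
  have r2 : reg L = 2%N by rewrite /reg asboolF.
  by have [uC _] := hu; rewrite r2 in uC.
have [_ [_ /(_ 1)[_ [ddu /(_ 1)[cddu _]]]]] := uC2.
pose w := 'D_1 ('D_1 u).
have Dg (x : R) : is_derive x 1 curve (1, 'D_1 u x, w x, n' x).
  exact: (is_derive_pair (is_derive_pair (is_derive_pair (is_derive_id x (1 : R))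
    (derivableP (@du x))) (derivableP (ddu x 1))) (is_derive_conv_S x)).
have cD : continuous (fun x => (1, 'D_1 u x, w x, n' x) : phase).
  have [cu' _] := bu'.
  exact: (continuous_pair (continuous_pair (continuous_pair
    (@cst_continuous R R 1) cu') cddu) continuous_n').
pose f i : phase -> R := 'D_((0, 0, delta_mx i 0, 0) : phase) Lp.
have f1 i : Ck 1 (f i) by exact: (Ck_derive _ (uncurried_C2 hL)).
pose gv' x : vec := \col_i 'D_((1, 'D_1 u x, w x, n' x) : phase) (f i) (curve x).
have Dgv (x : R) : is_derive x 1 (along (grad_v L) K S u) (gv' x).
  apply: is_derive_mx => i j; rewrite (ord1 j) mxE.
  rewrite (_ : (fun y => _) = f i \o curve).
    exact: (C1_comp_curve (@findim_phase R d) (f1 i) (Dg x)).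
  by apply/funext => y; rewrite alongE grad_v_entry.
exists w, gv'; split.
- exact: cddu.
- apply: continuous_mxP => i j; under eq_fun do rewrite mxE.
  exact: (C1_derive_continuous (@findim_phase R d) (f1 i) continuous_curve cD).
- move=> x; rewrite LE.
  exact: (C1_comp_curve (@findim_phase R d) (uncurried_C1 hL) (Dg x)).
- exact: Dgv.
- by move=> x; exact: (is_derive_dotv (Dgv x) (derivableP (ddu x 1))).
Qed.

End Jet.

(** * The local balance law *)

Section ConvLinear.
Context {R : realType} {d : nat}.
Notation vec := 'cV[R]_d.
Variable K : R -> 'M[R]_d.
Hypothesis iK : forall i j,
  (@lebesgue_measure R).-integrable [set: R] (fun r => (K r i j)%:E).

Lemma conv_dotv (f : R -> vec) (x : R) (a : vec) : conv_defined K f x ->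
  (@lebesgue_measure R).-integrable [set: R] (EFin \o (fun y => dotv a (K (x - y) *m f y))) /\
  \int[lebesgue_measure]_y dotv a (K (x - y) *m f y) = dotv a (conv K f x).
Proof.
move=> cd.
have iF i : (@lebesgue_measure R).-integrable [set: R]
    (EFin \o (fun y => a i 0 * (K (x - y) *m f y) i 0)).
  exact: (integrableZl measurableT (a i 0) (cd i)).
have [H1 H2] := Rintegral_sum (index_enum 'I_d) iF.
split=> //; rewrite [LHS]H2; apply: eq_bigr => i _.
by rewrite RintegralZl//; [rewrite [conv K f x i 0]mxE|exact: cd].
Qed.

Lemma conv_linear (f g : R -> vec) (a x : R) : bcont f -> bcont g ->
  conv K (fun y => f y + a *: g y) x = conv K f x + a *: conv K g x.
Proof.
move=> bf bg; apply/matrixP => i j; rewrite (ord1 j) !mxE.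
have cf := bcont_conv_defined iK x bf i; have cg := bcont_conv_defined iK x bg i.
rewrite -RintegralZl// -RintegralD//; last exact: (integrableZl measurableT a cg).
congr Rintegral; apply/funext => y.
by rewrite mulmxDr -scalemxAr !mxE.
Qed.

End ConvLinear.

(** Cancellation in Noether's argument, with [D1] the partial derivative of the Lagrangian
in position.  [a1], [a2], [a3] are the pairings of [grad_u L] with [X u], of the
derivative of [grad_v L] with [X u], and of [grad_v L] with the derivative of [X u];
[b1], [b2], [b3] are the same with [u'] in place of [X u].  [c1], [c2] are the pairings
of [grad_n L] with the two convolutions, and [k1], [k2] the nonlocal terms of (EL).  The
hypotheses are the symmetry identity and (EL) tested against [X u] and [u']. *)
Lemma balance_algebra (R : comPzRingType) (t D1 a1 a2 a3 b1 b2 b3 c1 c2 k1 k2 : R) :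
  - t * D1 + a1 + a3 + c1 = 0 -> a1 - a2 + k1 = 0 -> b1 - b2 + k2 = 0 ->
  - t * (D1 + b1 + b3 + c2) + (a2 + a3) + t * (b2 + b3) =
  k1 + t * k2 - (c1 + t * c2).
Proof.
move=> h1 h2 h3; apply/eqP; rewrite -subr_eq0; apply/eqP.
transitivity ((- t * D1 + a1 + a3 + c1) - (a1 - a2 + k1) - t * (b1 - b2 + k2)); first by ring.
by rewrite h1 h2 h3 mulr0 !subr0.
Qed.

Section Balance.
Context {R : realType} {d : nat}.
Notation vec := 'cV[R]_d.
Notation mat := 'M[R]_d.
Notation phase := (R * vec * vec * vec)%type.
Variables (K : R -> mat) (S : vec -> vec) (L : R -> vec -> vec -> vec -> R).
Variables (xi : mat * R) (u : R -> vec).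
Hypothesis hK : even_sym_kernel K.
Hypothesis hS : Ck 1 S.
Hypothesis hL : lagrangian_C2 L.
Hypothesis hu : Cb (reg L) u.
Notation Lp := (uncurried L).
Notation mu := (@lebesgue_measure R).

Lemma kernel_integrable i j : mu.-integrable [set: R] (fun r => (K r i j)%:E).
Proof. by case: hK. Qed.
Let iK := kernel_integrable.

Lemma kernel_even r : K (- r) = K r. Proof. by case: hK. Qed.
Lemma kernel_sym r : (K r)^T = K r. Proof. by case: hK. Qed.

Let bu : bcont u. Proof. by have [] := Cb_bcont hu. Qed.
Let du (x : R) : derivable u x 1. Proof. by have [_ + _] := Cb_bcont hu; exact. Qed.
Let bu' : bcont ('D_1 u). Proof. by have [] := Cb_bcont hu. Qed.

Definition load (y : R) : vec := Dmat S (u y) *m inf_fun xi u y.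

Lemma inf_fun_eq : inf_fun xi u = fun y => xi.1 *m u y + xi.2 *: 'D_1 u y.
Proof. by apply/funext => y; rewrite inf_funE//; exact: (@du y). Qed.

Lemma bcont_inf_fun : bcont (inf_fun xi u).
Proof. by rewrite inf_fun_eq; apply: bcontD; [exact: bcont_mulmxl|exact: bcont_scale]. Qed.

Lemma bcont_load : bcont load.
Proof. exact: (bcont_Dmat_mul hS bu bcont_inf_fun). Qed.

Let gn := along (grad_n L) K S u.

Lemma continuous_grad_n : continuous gn.
Proof.
apply: continuous_mxP => i j; rewrite (ord1 j).
rewrite (_ : (fun x => _) = fun x => 'D_((0, 0, 0, delta_mx i 0) : phase) Lp (curve K S u x)).
  apply: (C1_derive_continuous (@findim_phase R d) (uncurried_C1 hL)
    (continuous_curve iK hS hu)); exact: cst_continuous.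
by apply/funext => x; rewrite /gn alongE grad_n_entry.
Qed.

Lemma continuous_grad_v : continuous (along (grad_v L) K S u).
Proof.
apply: continuous_mxP => i j; rewrite (ord1 j).
rewrite (_ : (fun x => _) = fun x => 'D_((0, 0, delta_mx i 0, 0) : phase) Lp (curve K S u x)).
  apply: (C1_derive_continuous (@findim_phase R d) (uncurried_C1 hL)
    (continuous_curve iK hS hu)); exact: cst_continuous.
by apply/funext => x; rewrite alongE grad_v_entry.
Qed.

Lemma continuous_along_L : continuous (along L K S u).
Proof.
rewrite (_ : along L K S u = Lp \o curve K S u); last by apply/funext => x; rewrite alongE.
have [cLp _] := uncurried_C1 hL.
move=> x; exact: (continuous_comp (continuous_curve iK hS hu (x := x)) (cLp (curve K S u x))).
Qed.

Lemma sigma_out (x : R) :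
  mu.-integrable [set: R] (EFin \o (fun y => sigma L K S xi u x y)) /\
  \int[mu]_y sigma L K S xi u x y = dotv (gn x) (conv K load x).
Proof. exact: conv_dotv (bcont_conv_defined iK x bcont_load). Qed.

(** Exchanging the arguments of [sigma] moves the kernel to the other side of the scalar
product, by its symmetry, and reverses the sign of its argument, which is absorbed by
evenness. *)
Lemma sigma_in (x : R) : conv_defined K gn x ->
  mu.-integrable [set: R] (EFin \o (fun y => sigma L K S xi u y x)) /\
  \int[mu]_y sigma L K S xi u y x = dotv (conv K gn x) (load x).
Proof.
move=> cd; have := conv_dotv (load x) cd; rewrite dotvC.
rewrite (_ : (fun y => dotv _ _) = (fun y => sigma L K S xi u y x))//.
apply/funext => y; rewrite /sigma dotvC -[in LHS](kernel_sym (x - y)) dotv_trmul.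
by rewrite -kernel_even opprB.
Qed.

Definition local_current (x : R) : R :=
  along L K S u x * inf_one xi + dotv (along (grad_v L) K S u x) (inf_fun xi u x).

Lemma continuous_local_current : continuous local_current.
Proof.
have [ci _] := bcont_inf_fun.
move=> x; apply: cvgD; last exact: (continuous_dotv continuous_grad_v ci).
by apply: cvgM; [exact: continuous_along_L|exact: cvg_cst].
Qed.

(** Noether's computation: the local part of the current has a derivative which is purely
nonlocal on solutions. *)
Lemma local_current_balance : inf_symmetry L K S xi -> solves_EL L K S u ->
  exists P' : R -> R, [/\ continuous P',
    forall x : R, is_derive x 1 local_current (P' x) &
    forall x, P' x = dotv (conv K gn x) (load x) - dotv (gn x) (conv K load x)].
Proof.
move=> sym EL.
have [w [gv' [cw cgv' Dell Dgv Dgvu]]] := second_derivative_data iK hS hL hu.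
set n' := conv K (fun y => Dmat S (u y) *m 'D_1 u y) in Dell.
set t := xi.2; set X := xi.1.
pose m := conv K (fun y => Dmat S (u y) *m (X *m u y)).
pose gv := along (grad_v L) K S u.
pose gu := along (grad_u L) K S u.
pose ell' x : R := 'D_((1, 'D_1 u x, w x, n' x) : phase) Lp (curve K S u x).
pose P' x := - t * ell' x + (dotv (gv' x) (X *m u x) + dotv (gv x) (X *m 'D_1 u x)) +
  t * (dotv (gv' x) ('D_1 u x) + dotv (gv x) (w x)).
have [[cu _] [cu' _]] := (bu, bu').
have [cXu _] := bcont_mulmxl X bu; have [cXu' _] := bcont_mulmxl X bu'.
have cell' : continuous ell'.
  have cD : continuous (fun x => (1, 'D_1 u x, w x, n' x) : phase).
    exact: (continuous_pair (continuous_pair (continuous_pair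
      (@cst_continuous R R 1) cu') cw) (continuous_n' iK hS hu)).
  exact: (C1_derive_continuous (@findim_phase R d) (uncurried_C1 hL)
    (continuous_curve iK hS hu) cD).
exists P'; split.
- move=> x; apply: cvgD; first apply: cvgD.
  + by apply: cvgM; [exact: cvg_cst|exact: cell'].
  + by apply: cvgD; [exact: (continuous_dotv cgv' cXu)|exact: (continuous_dotv continuous_grad_v cXu')].
  + apply: cvgM; first exact: cvg_cst.
    by apply: cvgD; [exact: (continuous_dotv cgv' cu')|exact: (continuous_dotv continuous_grad_v cw)].
- move=> x.
  have lE y : local_current y = - t * along L K S u y + dotv (gv y) (X *m u y) +
      t * dotv (gv y) ('D_1 u y).
    have iE : inf_fun xi u y = X *m u y + t *: 'D_1 u y by rewrite inf_fun_eq.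
    by rewrite /local_current iE inf_oneE dotvDr dotvZr mulrC addrA.
  rewrite (_ : local_current = ((- t) *: along L K S u + (fun y => dotv (gv y) (X *m u y)))
    + t *: (fun y => dotv (gv y) ('D_1 u y))); last by apply/funext => y; exact: lE.
  have DXu := is_derive_mulmxl X (derivableP (@du x)).
  exact: (is_deriveD (is_deriveD (is_deriveZ (- t) (Dell x)) (is_derive_dotv (Dgv x) DXu))
    (is_deriveZ t (Dgvu x))).
move=> x.
have SI := symmetry_identity iK hS hL bu (@du) bu' (fun a b => sym u a b hu) x.
rewrite derive_phaseE// in SI.
have EL1 v : dotv (gu x) v - dotv (gv' x) v + dotv (conv K gn x) (Dmat S (u x) *m v) = 0.
  have [_ ELx] := EL x.
  have := congr1 (fun a => dotv a v) ELx.
  rewrite dotv0l !dotvDl dotvNl dotv_trmul derive1E.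
  by have [_ ->] := Dgv x.
have ELA := EL1 (X *m u x); have ELu := EL1 ('D_1 u x).
have loadE y : load y = Dmat S (u y) *m (X *m u y) + t *: (Dmat S (u y) *m 'D_1 u y).
  by rewrite /load inf_fun_eq mulmxDr -scalemxAr.
have -> : conv K load x = m x + t *: n' x.
  rewrite -(conv_linear iK).
  - by congr conv; apply/funext => y; rewrite loadE.
  - exact: (bcont_Dmat_mul hS bu (bcont_mulmxl X bu)).
  - exact: (bcont_Dmat_mul hS bu bu').
rewrite loadE !dotvDr !dotvZr /P' /ell' derive_phaseE// mul1r.
rewrite -!(@alongE _ _ K S) in SI *.
move: SI ELA ELu; rewrite -/gu -/gv -/gn -/m -/t -/X.
move=> h1 h2 h3; exact: (balance_algebra _ _ h1 h2 h3).
Qed.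

End Balance.

(** * The nonlocal density *)

Section NonlocalDensity.
Context {R : realType} {d : nat}.
Notation vec := 'cV[R]_d.
Notation mat := 'M[R]_d.
Notation mu := (@lebesgue_measure R).
Notation mu2 := (@lebesgue_measure R \x @lebesgue_measure R)%E.
Variables (K : R -> mat) (S : vec -> vec) (L : R -> vec -> vec -> vec -> R).
Variables (xi : mat * R) (u : R -> vec).
Hypothesis hK : even_sym_kernel K.
Hypothesis hS : Ck 1 S.
Hypothesis hL : lagrangian_C2 L.
Hypothesis hu : Cb (reg L) u.

Let iK := kernel_integrable hK.
Let bu : bcont u. Proof. by have [] := Cb_bcont hu. Qed.
Let du (x : R) : derivable u x 1. Proof. by have [_ + _] := Cb_bcont hu; exact. Qed.

Let gn := along (grad_n L) K S u.
Let ld := load S xi u.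
Let s : R * R -> R := B_integrand L K S xi u.

(** Shifting the Lagrangian together with the curve shifts everything evaluated along
it, since the convolution commutes with translations. *)
Lemma along_phi (T : Type) (F : R -> vec -> vec -> vec -> T) (x y : R) :
  along (phi x F) K S (phi x u) y = along F K S u (y + x).
Proof.
have E1 : derive1 (phi x u) y = derive1 u (y + x).
  rewrite !derive1E.
  by have [_ ->] := is_derive_comp_shift (derivableP (@du (y + x))).
have E2 : conv K (S \o phi x u) y = conv K (S \o u) (y + x).
  exact: (conv_shift iK x y (bcont_S_comp hS bu)).
by rewrite /along E1 E2.
Qed.

Lemma inf_fun_phi (x y : R) : inf_fun xi (phi x u) y = inf_fun xi u (y + x).
Proof.
have [D1 D2] := is_derive_comp_shift (derivableP (@du (y + x))).
rewrite (@inf_funE _ _ xi (phi x u) y D1) (@inf_funE _ _ xi u (y + x) (@du (y + x))).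
by rewrite -D2.
Qed.

Lemma B_integrand_phi (x : R) (p : R * R) :
  B_integrand (phi x L) K S xi (phi x u) p = s (p.1 + x, p.2 + x).
Proof.
have sE a b : sigma (phi x L) K S xi (phi x u) a b = sigma L K S xi u (a + x) (b + x).
  rewrite /sigma inf_fun_phi -[along (grad_n (phi x L)) _ _ _ _]/(along (phi x (grad_n L)) K S (phi x u) a).
  by rewrite along_phi opprD addrACA subrr addr0.
by rewrite /s /B_integrand !sE.
Qed.

Let h i j (a b : R) : R := gn a i 0 * ld b j 0 - gn b i 0 * ld a j 0.

(** The kernel factors out of the antisymmetrised density because it is even; what
remains is continuous. *)
Lemma B_integrandE (a b : R) : s (a, b) = \sum_i \sum_j K (a - b) i j * h i j a b.
Proof.
have sE x y : sigma L K S xi u x y = \sum_i \sum_j K (x - y) i j * (gn x i 0 * ld y j 0).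
  rewrite /sigma /dotv; apply: eq_bigr => i _; rewrite [(K _ *m _) i 0]mxE mulr_sumr.
  by apply: eq_bigr => j _; rewrite mulrCA.
rewrite /s /B_integrand/= !sE -(kernel_even hK (b - a)) opprB -sumrB.
apply: eq_bigr => i _; rewrite -sumrB; apply: eq_bigr => j _.
by rewrite -mulrBr.
Qed.

Lemma B_integrand_antisym (a b : R) : s (b, a) = - s (a, b).
Proof. by rewrite /s /B_integrand/= opprB. Qed.

Let cgi i : continuous (fun x => gn x i 0 : R).
Proof. exact: (continuous_mx_entry (continuous_grad_n hK hS hL hu)). Qed.

Let clj j : continuous (fun x => ld x j 0 : R).
Proof. by have [cl _] := bcont_load xi hS hu; exact: continuous_mx_entry. Qed.

Let mh i j (x : R) : measurable_fun [set: R * R] (fun p => h i j (p.1 + x) (p.2 + x)).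
Proof.
have m1 (f : R -> R) : continuous f -> measurable_fun [set: R * R] (fun p : R * R => f (p.1 + x)).
  move=> cf; apply: measurableT_comp; first exact: continuous_measurable_fun.
  exact: measurable_funD.
have m2 (f : R -> R) : continuous f -> measurable_fun [set: R * R] (fun p : R * R => f (p.2 + x)).
  move=> cf; apply: measurableT_comp; first exact: continuous_measurable_fun.
  exact: measurable_funD.
apply: measurable_funB; apply: measurable_funM.
- exact: (m1 _ (@cgi i)).
- exact: (m2 _ (@clj j)).
- exact: (m2 _ (@cgi i)).
- exact: (m1 _ (@clj j)).
Qed.

Let mk i j : measurable_fun [set: R] (fun r => K r i j).
Proof. by have /integrableP[/measurable_EFinP] := iK i j. Qed.

Lemma measurable_B_integrand : measurable_fun [set: R * R] s.
Proof.
rewrite (_ : s = fun p => \sum_i \sum_j K (p.1 - p.2) i j * h i j p.1 p.2); last first.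
  by apply/funext => -[a b]; rewrite B_integrandE.
apply: measurable_sum => i; apply: measurable_sum => j; apply: measurable_funM.
  exact: (measurable_kernel_diff (mk i j)).
rewrite (_ : (fun p => _) = fun p : R * R => h i j (p.1 + 0) (p.2 + 0)); first exact: (@mh i j 0).
by apply/funext => p; rewrite !addr0.
Qed.

Lemma B_integrand_integrable (D : set (R * R)) (x M : R) : measurable D ->
  (forall i j, mu2.-integrable D (fun p => (K (p.1 - p.2) i j)%:E)) ->
  (forall i j p, D p -> `|h i j (p.1 + x) (p.2 + x)| <= M) ->
  mu2.-integrable D (fun p => (s (p.1 + x, p.2 + x))%:E).
Proof.
move=> mD ik hM.
rewrite (_ : (fun p => _) = (fun p : R * R => (\sum_i \sum_j
    (K (p.1 - p.2) i j * h i j (p.1 + x) (p.2 + x))%:E)%E)); last first.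
  apply/funext => p; rewrite B_integrandE opprD addrACA subrr addr0.
  by rewrite -sumEFin; apply: eq_bigr => i _; rewrite sumEFin.
apply: integrable_sum => // i _; apply: integrable_sum => // j _.
exact: (integrable_weighted mD (ik i j) (mh i j x) (hM i j)).
Qed.

(** This is what the finite first moment of the kernel provides. *)
Lemma kernel_quadrant_integrable i j :
  mu2.-integrable (@quadrant R) (fun p => (K (p.1 - p.2) i j)%:E).
Proof.
apply: (@integrable_quadrant_kernel _ (fun r => K r i j)) => //.
have [_ _ _ ik4] := hK.
apply: le_integrable ik4 => //.
  by apply/measurable_EFinP; apply: measurable_funM; [exact: normr_measurable|exact: (measurableT_comp (@normr_measurable R setT) (@mk i j))].
move=> r _ /=; rewrite lee_fin !normrM !normr_id.
rewrite ler_pM//; last exact: mx_entry_le.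
by rewrite ger0_norm ?addr_ge0// lerDr.
Qed.

Lemma quadrant_shift (x : R) :
  mu2.-integrable (@quadrant R) (fun p => (s (p.1 + x, p.2 + x))%:E) ->
  mu2.-integrable (quadrant_at x) (EFin \o s) /\
  \int[mu2]_(p in @quadrant R) s (p.1 + x, p.2 + x) = \int[mu2]_(p in quadrant_at x) s p.
Proof.
move=> iq.
have mqx : measurable (quadrant_at x).
  rewrite (_ : quadrant_at x = `]-oo, x[ `*` `]x, +oo[).
    by apply: measurableX; exact: measurable_itv.
  by apply/seteqP; split => -[a b] /=; rewrite /quadrant_at/= !in_itv/= andbT.
pose T (y : R) (p : measurableTypeR R * measurableTypeR R) : measurableTypeR R * measurableTypeR R :=
  (p.1 + y, p.2 + y).
have E : (fun p => (s (p.1 + x, p.2 + x))) \_ (@quadrant R) = (s \_ (quadrant_at x)) \o T x.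
  apply/funext => -[a b]; rewrite /= !patchE; congr (if _ then _ else _).
  have lt1 : (a + x < x) = (a < 0) by rewrite -ltrBrDr subrr.
  have lt2 : (x < b + x) = (0 < b) by rewrite -ltrBlDr subrr.
  by apply/idP/idP; rewrite !inE /quadrant /quadrant_at /T/= lt1 lt2.
have i1 : mu2.-integrable [set: R * R] (EFin \o ((s \_ (quadrant_at x)) \o T x)).
  rewrite -E -restrict_EFin.
  exact: (iffLR (@integrable_mkcond _ _ _ mu2 _ _ measurable_quadrant) iq).
have i2 : mu2.-integrable [set: R * R] (EFin \o (s \_ (quadrant_at x))).
  have E2 : EFin \o (s \_ (quadrant_at x)) =
      (EFin \o ((s \_ (quadrant_at x)) \o T x)) \o T (- x).
    by apply/funext => -[a b]; rewrite /T/= (subrK x a) (subrK x b).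
  rewrite E2; exact: (@integrable_preserving _ _ _ mu2 (T (- x)) (measurable_shift2 (- x))
    (fun A mA => lebesgue2_shift (- x) mA) _ i1).
split.
  apply: (iffRL (@integrable_mkcond _ _ _ mu2 _ _ mqx)).
  by rewrite restrict_EFin.
rewrite Rintegral_mkcond E [RHS]Rintegral_mkcond.
exact: (@Rintegral_preserving _ _ _ mu2 (T x) (measurable_shift2 x)
    (fun A mA => lebesgue2_shift x mA) _ i2).
Qed.

End NonlocalDensity.

(** * Regularity and constancy of the current *)

(** Fundamental theorem of calculus for [ell], against [flux_difference] for [s]. *)
Lemma current_flux_balance {R : realType} (s : R * R -> R) (ell P' : R -> R) (x1 x2 : R) :
  x1 < x2 -> continuous ell -> continuous P' ->
  (forall x : R, is_derive x 1 ell (P' x)) ->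
  measurable_fun [set: R * R] s -> (forall a b, s (b, a) = - s (a, b)) ->
  (@lebesgue_measure R \x @lebesgue_measure R)%E.-integrable (quadrant_at x1) (EFin \o s) ->
  (@lebesgue_measure R \x @lebesgue_measure R)%E.-integrable (quadrant_at x2) (EFin \o s) ->
  (@lebesgue_measure R \x @lebesgue_measure R)%E.-integrable (`[x1, x2] `*` `[x1, x2]) (EFin \o s) ->
  (forall a, (@lebesgue_measure R).-integrable [set: R] (fun b => (s (a, b))%:E) /\
     \int[@lebesgue_measure R]_b s (a, b) = - P' a) ->
  ell x1 + \int[(@lebesgue_measure R \x @lebesgue_measure R)%E]_(p in quadrant_at x1) s p =
  ell x2 + \int[(@lebesgue_measure R \x @lebesgue_measure R)%E]_(p in quadrant_at x2) s p.
Proof.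
move=> x12 cP cP' DP ms antis q1 q2 sq sint.
have fluxE := flux_difference ms antis x12 q1 q2 sq (fun a => (sint a).1).
apply/eqP; rewrite eq_sym -subr_eq0 opprD addrACA.
rewrite fluxE.
have -> : (fun a => \int[@lebesgue_measure R]_b s (a, b)) = (fun a => -1 * P' a).
  by apply/funext => a; rewrite (sint a).2 mulN1r.
rewrite RintegralZl//; last exact: (continuous_integrable x1 x2 cP').
have F : (\int[@lebesgue_measure R]_(x in `[x1, x2]) (P' x)%:E =
   (ell x2)%:E - (ell x1)%:E)%E.
  apply: continuous_FTC2 => //.
  - exact: continuous_subspaceT.
  - split.
    + by move=> x _; have [] := DP x.
    + exact: (cvg_at_right_filter (cP x1)).
    + exact: (cvg_at_left_filter (cP x2)).
  - by move=> x _; rewrite derive1E; have [_] := DP x.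
by rewrite /Rintegral F/= mulN1r subrr.
Qed.

Section Conservation.
Context {R : realType} {d : nat}.
Notation vec := 'cV[R]_d.
Notation mat := 'M[R]_d.
Notation mu := (@lebesgue_measure R).
Notation mu2 := (@lebesgue_measure R \x @lebesgue_measure R)%E.
Variables (K : R -> mat) (S : vec -> vec) (L : R -> vec -> vec -> vec -> R).
Variables (xi : mat * R) (u : R -> vec).
Hypothesis hK : even_sym_kernel K.
Hypothesis hS : Ck 1 S.
Hypothesis hL : lagrangian_C2 L.
Hypothesis hu : Cb (reg L) u.

Let iK := kernel_integrable hK.
Let gn := along (grad_n L) K S u.
Let ld := load S xi u.
Let s : R * R -> R := B_integrand L K S xi u.

Lemma B_integrand_phiE (x : R) :
  B_integrand (phi x L) K S xi (phi x u) = fun p => s (p.1 + x, p.2 + x).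
Proof. by apply/funext => p; exact: (B_integrand_phi xi hK hS hu x p). Qed.

Lemma C_definedE (x : R) : C_defined L K S xi u x =
  mu2.-integrable (@quadrant R) (fun p => (s (p.1 + x, p.2 + x))%:E).
Proof. by rewrite /C_defined /B_defined B_integrand_phiE. Qed.

Lemma C_funE (x : R) : C_fun L K S xi u x = local_current K S L xi u x +
  \int[mu2]_(p in @quadrant R) s (p.1 + x, p.2 + x).
Proof. by rewrite /C_fun /B_fun B_integrand_phiE. Qed.

Lemma weight_le (g l g' l' : vec) (G M : R) i j : `|g| <= G -> `|l| <= M ->
  `|g'| <= G -> `|l'| <= M ->
  `|g i 0 * l j 0 - g' i 0 * l' j 0| <= G * M + G * M.
Proof.
move=> gG lM gG' lM'; rewrite (le_trans (ler_normB _ _))// !normrM.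
by rewrite lerD// ler_pM// (le_trans (mx_entry_le _ _ _)).
Qed.

Lemma square_integrable (a b : R) : mu2.-integrable (`[a, b] `*` `[a, b]) (EFin \o s).
Proof.
have [G _ GP] := compact_continuous_bounded (segment_compact (a := a) (b := b))
  (continuous_grad_n hK hS hL hu).
have [cl _] := bcont_load xi hS hu.
have [M _ MP] := compact_continuous_bounded (segment_compact (a := a) (b := b)) cl.
have mD : measurable (`[a, b] `*` `[a, b] : set (R * R)).
  by apply: measurableX; exact: measurable_itv.
have := @B_integrand_integrable _ _ K S L xi u hK hS hL hu _ 0 (G * M + G * M) mD.
rewrite (_ : (fun p => _) = EFin \o s); last first.
  by apply/funext => -[x y]; rewrite /= (addr0 x) (addr0 y).
apply=> [i j|i j [x y]].
  exact: (integrable_square_kernel a b (iK i j)).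
rewrite /= => -[xab yab]; rewrite (addr0 x) (addr0 y).
by apply: weight_le; [exact: GP|exact: MP|exact: GP|exact: MP].
Qed.

(** The local and the nonlocal parts of the current have opposite increments over every
interval. *)
Lemma current_constant : inf_symmetry L K S xi -> solves_EL L K S u ->
  (forall x : R, C_defined L K S xi u x) ->
  exists c : R, forall x : R, C_fun L K S xi u x = c.
Proof.
move=> sym EL Cd.
have [P' [cP' DP P'E]] := local_current_balance hK hS hL hu sym EL.
suff H x1 x2 : x1 < x2 -> C_fun L K S xi u x1 = C_fun L K S xi u x2.
  exists (C_fun L K S xi u 0) => x.
  by have [x0|x0|->//] := ltgtP x 0; [exact: H|exact/esym/H].
move=> x12.
have Q x : mu2.-integrable (quadrant_at x) (EFin \o s) /\
  \int[mu2]_(p in @quadrant R) s (p.1 + x, p.2 + x) = \int[mu2]_(p in quadrant_at x) s p.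
  by apply: (quadrant_shift (x := x)); have := Cd x; rewrite C_definedE.
have [q1 E1] := Q x1; have [q2 E2] := Q x2.
have sint a : mu.-integrable [set: R] (fun b => (s (a, b))%:E) /\
    \int[mu]_b s (a, b) = - P' a.
  have [e1 e2] := sigma_out xi hK hS hu a.
  have [i1 i2] := sigma_in xi hK (EL a).1.
  split; first exact: (integrableB _ e1 i1).
  apply: (etrans (RintegralB measurableT e1 i1)).
  apply: (etrans (congr2 (fun a b => a - b) e2 i2)).
  by apply: esym; apply: (etrans (congr1 -%R (P'E a))); exact: opprB.
apply: (etrans (C_funE x1)); apply: esym; apply: (etrans (C_funE x2)).
apply: (etrans (congr1 (+%R _) E2)); apply: esym; apply: (etrans (congr1 (+%R _) E1)).
apply: (current_flux_balance x12 (@continuous_local_current _ _ K S L xi u hK hS hL hu) cP' DP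
  (measurable_B_integrand xi hK hS hL hu) (B_integrand_antisym K S L xi u) q1 q2
  (square_integrable x1 x2) sint).
Qed.

(** The bounds on [L] and its gradients are taken on a ball containing the jet of [u];
they make a constant multiple of the kernel a common majorant of all translated
densities on the quadrant. *)
Lemma current_regular : position_bounded L ->
  (forall x : R, conv_defined K gn x) /\
  (forall x : R, C_defined L K S xi u x) /\
  Cb 0 (C_fun L K S xi u : R -> R).
Proof.
move=> pb.
have [[cu [Mu uM]] du [cu' [Mu' u'M]]] := Cb_bcont hu.
have [cN [MN NM]] := bcont_conv_S iK hS hu.
have [N NP] := pb (Num.max Mu (Num.max Mu' MN)).
have NP' x := NP x (u x) ('D_1 u x) (conv K (S \o u) x).
have {}NP x : [/\ `|along L K S u x| <= N, `|along (grad_v L) K S u x| <= N &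
    `|gn x| <= N].
  rewrite /gn !alongE; apply: NP'; rewrite !le_max.
  - by rewrite uM.
  - by rewrite u'M orbT.
  - by rewrite NM !orbT.
have N0 : 0 <= N by have [_ _] := NP 0; exact: le_trans.
have bld := bcont_load xi hS hu.
have [cl [Ml lM]] := bld.
have [ci [Mi iM]] := bcont_inf_fun xi hu.
have Mi0 : 0 <= Mi by exact: le_trans (normr_ge0 _) (iM 0).
have bgn : bcont gn.
  by split; [exact: (continuous_grad_n hK hS hL hu)|exists N => x; have [] := NP x].
pose B := N * Ml + N * Ml.
have hB i j a b : `|gn a i 0 * ld b j 0 - gn b i 0 * ld a j 0| <= B.
  by apply: weight_le; [have [] := NP a|exact: lM|have [] := NP b|exact: lM].
have kq := kernel_quadrant_integrable hK.
have iq x : mu2.-integrable (@quadrant R) (fun p => (s (p.1 + x, p.2 + x))%:E).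
  apply: (@B_integrand_integrable _ _ K S L xi u hK hS hL hu _ x B measurable_quadrant) => //.
split; [by move=> x; exact: (bcont_conv_defined iK x bgn)|split].
  by move=> x; rewrite C_definedE.
pose g (p : R * R) : R := \sum_i \sum_j `|K (p.1 - p.2) i j| * B.
have ig : mu2.-integrable (@quadrant R) (EFin \o g).
  rewrite (_ : _ \o _ = fun p : R * R => (\sum_i \sum_j (B%:E * `|(K (p.1 - p.2) i j)%:E|))%E); last first.
    apply/funext => p; rewrite /= -sumEFin; apply: eq_bigr => i _.
    by rewrite -sumEFin; apply: eq_bigr => j _; rewrite mulrC.
  apply: integrable_sum => // [|i _]; first exact: measurable_quadrant.
  apply: integrable_sum => // [|j _]; first exact: measurable_quadrant.
  apply: integrableZl => //; first exact: measurable_quadrant.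
  exact: (integrable_abse (kq i j)).
have sg x p : `|s (p.1 + x, p.2 + x)| <= g p.
  rewrite /s (B_integrandE S L xi u hK) /g opprD addrACA subrr addr0.
  rewrite (le_trans (ler_norm_sum _ _ _))//; apply: ler_sum => i _.
  rewrite (le_trans (ler_norm_sum _ _ _))//; apply: ler_sum => j _.
  by rewrite normrM ler_wpM2l.
have cB : continuous (fun x => \int[mu2]_(p in @quadrant R) s (p.1 + x, p.2 + x)).
  move=> x.
  apply: (@continuity_under_integral _ _ _ mu2 (fun x p => s (p.1 + x, p.2 + x)) _ measurable_quadrant
     (x - 1) (x + 1) _ _ g) => //.
  - by move=> y _; exact: iq.
  - apply: aeW => p _ y _.
    have sE : (fun x => s (p.1 + x, p.2 + x)) = fun x => \sum_i \sum_j K (p.1 - p.2) i j *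
        (gn (p.1 + x) i 0 * ld (p.2 + x) j 0 - gn (p.2 + x) i 0 * ld (p.1 + x) j 0).
      apply/funext => z; rewrite /s (B_integrandE S L xi u hK) opprD addrACA subrr addr0.
      reflexivity.
    rewrite sE {sE}; apply: continuous_bigsum => i; apply: continuous_bigsum => j.
    have cg a : continuous (fun z => gn (a + z) i 0 : R).
      rewrite (_ : (fun z => _) = (fun z => gn (z + a) i 0)); last first.
        by apply/funext => z; rewrite (addrC a z).
      exact: (continuous_mx_entry (bcont_shift a bgn).1).
    have cl' a : continuous (fun z => ld (a + z) j 0 : R).
      rewrite (_ : (fun z => _) = (fun z => ld (z + a) j 0)); last first.
        by apply/funext => z; rewrite (addrC a z).
      exact: (continuous_mx_entry (bcont_shift a bld).1).
    move=> z; apply: cvgM; first exact: cvg_cst.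
    apply: cvgB; apply: cvgM; [exact: (cg p.1)|exact: (cl' p.2)|exact: (cg p.2)|exact: (cl' p.1)].
  - by move=> y _; apply: aeW => p _; exact: sg.
  - by rewrite inE/= in_itv/= ltrBlDr ltrDl ltr01.
have cP := @continuous_local_current _ _ K S L xi u hK hS hL hu.
have CE : C_fun L K S xi u = fun x => local_current K S L xi u x +
  \int[mu2]_(p in @quadrant R) s (p.1 + x, p.2 + x) by apply/funext => x; exact: C_funE.
split.
  by split; [rewrite CE => x; apply: cvgD; [exact: cP|exact: cB]|exact: I].
have lP x : `|local_current K S L xi u x| <= N * `|xi.2| + d%:R * (N * Mi).
  rewrite /local_current inf_oneE.
  have [N1 N2 _] := NP x.
  apply: (le_trans (ler_normD _ _)); apply: lerD.
    by rewrite normrM normrN; apply: ler_wpM2r.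
  apply: (le_trans (dotv_le _ _)); apply: ler_wpM2l; first exact: ler0n.
  by apply: ler_pM => //; exact: iM.
have lB x : `|\int[mu2]_(p in @quadrant R) s (p.1 + x, p.2 + x)| <=
    \int[mu2]_(p in @quadrant R) g p.
  have N1 := @le_normr_Rintegral _ _ _ mu2 _ (fun p => s (p.1 + x, p.2 + x))
    measurable_quadrant (iq x).
  apply: (le_trans N1).
  apply: le_Rintegral.
  - exact: measurable_quadrant.
  - exact: (integrable_abse (iq x)).
  - exact: ig.
  - by move=> p _; exact: sg.
move=> j; rewrite leqn0 => /eqP ->.
exists (N * `|xi.2| + d%:R * (N * Mi) + \int[mu2]_(p in @quadrant R) g p) => x.
rewrite derive1n0; apply: (le_trans _ (lerD (lP x) (lB x))).
have CEx := C_funE x.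
by rewrite [in leLHS]CEx; exact: ler_normD.
Qed.

End Conservation.

Theorem theorem2p5 (R : realType) (d : nat)
    (K : R -> 'M[R]_d) (S : 'cV[R]_d -> 'cV[R]_d)
    (L : R -> 'cV[R]_d -> 'cV[R]_d -> 'cV[R]_d -> R)
    (hK : even_sym_kernel K) (hS : Ck 2 S) (hL : lagrangian_C2 L)
    (g : set ('M[R]_d * R)) (hg : local_symmetry_algebra L K S g)
    (xi : 'M[R]_d * R) (hxi : g xi) :
  (position_bounded L -> forall u : R -> 'cV[R]_d, Cb (reg L) u ->
     (forall x : R, conv_defined K (along (grad_n L) K S u) x) /\
     (forall x : R, C_defined L K S xi u x) /\
     Cb 0 (C_fun L K S xi u : R -> R))
  /\
  (forall u : R -> 'cV[R]_d, Cb (reg L) u -> solves_EL L K S u ->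
     (forall x : R, C_defined L K S xi u x) ->
     exists c : R, forall x : R, C_fun L K S xi u x = c).
Proof.
have hS1 : Ck 1 S by exact: (Ck_le (leqnSn 1) hS).
split=> [pb u hu|u hu EL Cd].
  exact: (current_regular xi hK hS1 hL hu pb).
have [_ gsym _] := hg.
exact: (current_constant hK hS1 hL hu (gsym xi hxi) EL Cd).
Qed.
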